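(* There exists a constant $C>0$ such that for all integers $M\ge1$, $$0\le a_{\mathrm{Leb}}-\Lambda_M\le C\,M^{-2}.$$
   Context: $\mathcal E(2)$ is the group of all Euclidean isometries of $\mathbb R^2$ (including reflections). A compact convex set $U\subset\mathbb R^2$ is a universal cover if for every nonempty compact $K\subset\mathbb R^2$ with $\operatorname{diam}(K)\le1$ there is $g\in\mathcal E(2)$ with $gK\subset U$. $a_{\mathrm{Leb}}$ is the infimum of $\operatorname{area}(U)$ (two-dimensional Lebesgue measure) over all compact convex universal covers $U$. A convex body is a compact convex subset of $\mathbb R^2$ with nonempty interior. For a compact convex $K$, $h_K(\theta)=\max_{x\in K}\langle x,(\cos\theta,\sin\theta)\rangle$ is its support function. $\mathcal W_1$ is the set of convex bodies of constant width $1$, i.e. $h_K(\theta)+h_K(\theta+\pi)=1$ for all $\theta$. For $K\in\mathcal W_1$, the distribution $h_K+h_K''$ on the circle $\mathbb R/2\pi\mathbb Z$ is a measure absolutely continuous with respect to Lebesgue measure; its density is denoted $\rho_K$ and satisfies $\rho_K(\theta)+\rho_K(\theta+\pi)=1$ a.e. For odd $n\ge3$, $\mathcal R_n$ is the set of all $K\in\mathcal W_1$ such that $\rho_K$ is (a.e. equal to) a $0/1$-valued step function with finitely many pieces for which $\{\rho_K=1\}$ has exactly $n$ connected components on the circle, counted after choosing a finite-interval representative, deleting zero-length intervals and merging adjacent intervals. Let $D=\{x\in\mathbb R^2:|x|\le1/2\}$ and, for integers $M\ge1$, $\mathcal A_M=\{D\}\cup\bigcup_{m=1}^M\mathcal R_{2m+1}$.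 $\Lambda_M$ is the infimum of $\operatorname{area}(U)$ over all compact convex $U\subset\mathbb R^2$ such that for every $K\in\mathcal A_M$ there is $g\in\mathcal E(2)$ with $gK\subset U$. *)

(* Defs.v *)
From HB Require Import structures.
From mathcomp Require Import all_boot all_order all_algebra.
From mathcomp Require Import all_classical all_reals all_analysis.
Set Implicit Arguments.
Unset Strict Implicit.
Unset Printing Implicit Defensive.
Import Order.TTheory GRing.Theory Num.Theory.
Import numFieldNormedType.Exports.

Local Open Scope classical_set_scope.
Local Open Scope ring_scope.

Section Plane.
Context {R : realType}.
Notation plane := (R * R)%type.

(* The library norm on a product is the maximum norm, so the Euclidean metric
   is spelled out; the topology is the same. *)
Definition eucl_dist (x y : plane) : R :=
  Num.sqrt ((x.1 - y.1) ^+ 2 + (x.2 - y.2) ^+ 2).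

(* Distance-preserving maps of the plane are automatically bijective. *)
Definition euclidean_isometry (g : plane -> plane) : Prop :=
  forall x y, eucl_dist (g x) (g y) = eucl_dist x y.

Definition diam (K : set plane) : \bar R :=
  ereal_sup [set (eucl_dist xy.1 xy.2)%:E | xy in K `*` K].

Definition area (U : set plane) : \bar R :=
  ((@lebesgue_measure R) \x (@lebesgue_measure R))%E U.

Definition compact_convex (K : set plane) : Prop := compact K /\ convex_set K.

Definition convex_body (K : set plane) : Prop :=
  compact_convex K /\ interior K !=set0.

Definition convex_cover (F : set (set plane)) (U : set plane) : Prop :=
  compact_convex U /\
  forall K, F K -> exists2 g, euclidean_isometry g & g @` K `<=` U.

Definition unit_diameter_sets : set (set plane) :=
  [set K | [/\ K !=set0, compact K & (diam K <= 1%:E)%E]].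

Definition universal_cover : set (set plane) :=
  convex_cover unit_diameter_sets.

Definition a_Leb : \bar R := ereal_inf [set area U | U in universal_cover].

Definition circle_point (t : R) : plane := (cos t, sin t).

(* For nonempty compact [K] the supremum is a maximum. *)
Definition support_fun (K : set plane) (t : R) : R :=
  sup [set x.1 * cos t + x.2 * sin t | x in K].

Definition constant_width1 : set (set plane) :=
  [set K | convex_body K /\
     forall t, support_fun K t + support_fun K (t + pi) = 1].

(* Functions on the circle [R / 2 pi Z] are [2 pi]-periodic functions on [R]. *)
Definition circle_test_fun (phi : R -> R) : Prop :=
  periodic phi (pi *+ 2) /\
  forall (k : nat) (t : R), derivable (derive1n k phi) t 1.

(* The distribution [h + h''] on the circle is the measure with density [rho]
   with respect to [dt]. *)
Definition has_curvature_density (h rho : R -> R) : Prop :=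
  [/\ periodic rho (pi *+ 2),
      measurable_fun setT rho,
      lebesgue_measure.-integrable `[0, pi *+ 2] (EFin \o rho) &
      forall phi, circle_test_fun phi ->
        \int[lebesgue_measure]_(t in `[0, pi *+ 2])
          (h t * (phi t + derive1n 2 phi t))
        = \int[lebesgue_measure]_(t in `[0, pi *+ 2]) (phi t * rho t)].

(* The subset of the circle (as the unit circle of the plane) covered by the
   finitely many intervals [p.1, p.2[, [p] in [s]. Since the intervals are
   half-open, those of length zero are empty and adjacent ones merge in the
   union, so the connected components of [arcs s] are the normalized
   intervals. *)
Definition arcs (s : seq (R * R)) : set plane :=
  [set circle_point t | t in [set t | exists2 p, p \in s & p.1 <= t < p.2]].

Definition components (E : set plane) : set (set plane) :=
  [set connected_component E x | x in E].

Definition reuleaux (n : nat) : set (set plane) :=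
  [set K | constant_width1 K /\
     exists (rho : R -> R) (s : seq (R * R)),
       [/\ has_curvature_density (support_fun K) rho,
           {ae lebesgue_measure, forall t, rho t = \1_(arcs s) (circle_point t)} &
           (components (arcs s) #= `I_n)%card]].

Definition disk : set plane := [set x | eucl_dist x (0, 0) <= 2^-1].

Definition finite_arc_family (M : nat) : set (set plane) :=
  [set K | K = disk \/
     exists2 m : nat, (1 <= m <= M)%N & reuleaux (2 * m + 1)%N K].

Definition Lambda (M : nat) : \bar R :=
  ereal_inf [set area U | U in convex_cover (finite_arc_family M)].

End Plane.

Arguments a_Leb : clear implicits.
Arguments Lambda : clear implicits.

(* Main.v *)
(* Idea. Universal covers are the covers of all sets of diameter at most 1, so
   Lambda M <= a_Leb. For the upper bound it suffices to approximate every K of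
   diameter at most 1 within eps = O(M^-2) by a body K' of [reuleaux (2 M + 1)]:
   if U covers the disk and all these bodies, it contains a disk of radius 1/2
   around some c, and then the homothetic copy of U with ratio 1 + 2 eps and
   centre c covers K; its area is (1 + 2 eps)^2 times that of U.

   To build K', replace K by a finite net. For a direction u, Helly's theorem
   adds a pair of points y, y + u without increasing the diameter; do this for
   the directions u_j of angle j pi / M. After a slight perturbation, the
   displacement from the endpoint x_j of the j-th diameter to x_(j+1) equals
   u(b_j) - u(a_j) for angles j pi / M < a_j < b_j < (j + 1) pi / M. So there is
   a body of constant width 1 whose radius of curvature is 1 on the M arcs
   [a_j, b_j] and on the antipodes of the M + 1 gaps between them in [0, pi],
   and 0 elsewhere, and its boundary passes through all the x_j. It belongs to
   [reuleaux (2 M + 1)], and since in the directions u_j it is at least as far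
   out as the (perturbed) net, in the other directions it is so up to O(M^-2). *)

From HB Require Import structures.
Require Import Defs.
From mathcomp Require Import all_boot all_order all_algebra.
From mathcomp Require Import all_classical all_reals all_analysis.
From mathcomp Require Import measurable_realfun zify ring lra.
Set Implicit Arguments.
Unset Strict Implicit.
Unset Printing Implicit Defensive.
Import Order.TTheory GRing.Theory Num.Theory.
Import numFieldNormedType.Exports.

Local Open Scope classical_set_scope.
Local Open Scope ring_scope.

(** * Euclidean geometry of the plane *)

Section PlaneGeometry.
Context {R : realType}.
Notation plane := (R * R)%type.
Implicit Types (x y z : plane) (t s a b : R).

(** The inner product with the unit vector at angle [t]. The Euclidean distance is the largest
    difference of heights, so metric estimates become linear inequalities in each direction. *)
Definition height t x : R := x.1 * cos t + x.2 * sin t.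

Lemma sin2D t : sin t ^+ 2 + cos t ^+ 2 = 1.
Proof. by rewrite addrC cos2Dsin2. Qed.

(** The angle is [acos (a / r)] or, for negative [b], its reflection [2 pi - acos (a / r)]. Applied
    to a cosine and sine, this reduces any angle to [[0, 2 pi[]. *)
Lemma polar_coordinates a b : exists2 t, 0 <= t < pi *+ 2 &
  a = Num.sqrt (a ^+ 2 + b ^+ 2) * cos t /\
  b = Num.sqrt (a ^+ 2 + b ^+ 2) * sin t.
Proof.
set r := Num.sqrt _; have pi0 : 0 < pi :> R := pi_gt0 R.
have rE : r ^+ 2 = a ^+ 2 + b ^+ 2 by rewrite sqr_sqrtr// addr_ge0 ?sqr_ge0.
have [r0|rN0] := eqVneq r 0.
  exists 0; first by rewrite lexx/= pmulrn_lgt0.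
  have /eqP : a ^+ 2 + b ^+ 2 = 0 by rewrite -rE r0 expr0n.
  rewrite paddr_eq0 ?sqr_ge0// !sqrf_eq0 => /andP[/eqP -> /eqP ->].
  by rewrite r0 !mul0r.
have r_gt0 : 0 < r by rewrite lt_def rN0 sqrtr_ge0.
have ar1 : -1 <= a / r <= 1.
  rewrite ler_pdivlMr// ler_pdivrMr// mulN1r mul1r -ler_norml.
  by rewrite -(ler_pXn2r (ltn0Sn 1)) ?nnegrE ?sqrtr_ge0// rE real_normK ?num_real//
    lerDl sqr_ge0.
have sE : r * sin (acos (a / r)) = `|b|.
  rewrite sin_acos// -[RHS]sqrtr_sqr.
  rewrite -{1}(gtr0_norm r_gt0) -sqrtr_sqr -sqrtrM ?sqr_ge0//; congr Num.sqrt.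
  by rewrite mulrBr mulr1 exprMn exprVn mulrCA divff ?mulr1 ?sqrf_eq0// rE addrC addKr.
have cE : a = r * cos (acos (a / r)).
  by rewrite acosK ?in_itv//= mulrCA divff// mulr1.
have [t0 tpi] : 0 <= acos (a / r) /\ acos (a / r) <= pi.
  by rewrite acos_ge0 ?acos_lepi.
have [b0|b0] := leP 0 b.
  exists (acos (a / r)); first by rewrite t0/= mulr2n; lra.
  by split=> //; rewrite sE ger0_norm.
exists (pi *+ 2 - acos (a / r)).
  rewrite mulr2n; apply/andP; split; first lra.
  rewrite ltrBlDr ltrDl lt_neqAle t0 andbT eq_sym.
  apply/eqP => ac0; move: sE; rewrite ac0 sin0 mulr0 => /esym/normr0_eq0.
  by apply/eqP; rewrite lt_eqF.
rewrite addrC cosD2pi sinD2pi cosN sinN mulrN sE ltr0_norm// opprK.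
by split.
Qed.

Lemma eucl_distC x y : eucl_dist x y = eucl_dist y x.
Proof. by rewrite /eucl_dist; congr Num.sqrt; ring. Qed.

Lemma eucl_dist_ge0 x y : 0 <= eucl_dist x y.
Proof. exact: sqrtr_ge0. Qed.

Lemma eucl_dist_sqr x y : eucl_dist x y ^+ 2 = (x.1 - y.1) ^+ 2 + (x.2 - y.2) ^+ 2.
Proof. by rewrite sqr_sqrtr// addr_ge0 ?sqr_ge0. Qed.

Lemma eucl_dist_height x y : exists2 t, 0 <= t < pi *+ 2 &
  eucl_dist x y = height t x - height t y.
Proof.
have [t tpi [E1 E2]] := polar_coordinates (x.1 - y.1) (x.2 - y.2).
exists t => //; rewrite -/(eucl_dist x y) in E1 E2.
have := sin2D t; rewrite /height => E.
have -> : x.1 * cos t + x.2 * sin t - (y.1 * cos t + y.2 * sin t) =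
  (x.1 - y.1) * cos t + (x.2 - y.2) * sin t by ring.
by rewrite E1 E2 -[LHS]mulr1 -E; ring.
Qed.

Lemma height_le_dist t x y : height t x - height t y <= eucl_dist x y.
Proof.
apply: le_trans (ler_norm _) _.
rewrite -(ler_pXn2r (ltn0Sn 1)) ?nnegrE ?eucl_dist_ge0//.
rewrite real_normK ?num_real// eucl_dist_sqr -subr_ge0.
(* Lagrange's identity: what is missing from the squared length is the square of the orthogonal
   component. *)
rewrite (_ : _ - _ = ((x.1 - y.1) * sin t - (x.2 - y.2) * cos t) ^+ 2) ?sqr_ge0//.
have E := sin2D t; rewrite /height.
rewrite -[X in X - _]mulr1 -E; ring.
Qed.

Lemma eucl_dist_leP x y r :
  (forall t, 0 <= t < pi *+ 2 -> height t x - height t y <= r) ->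
  eucl_dist x y <= r.
Proof. by move=> H; have [t /H + ->] := eucl_dist_height x y. Qed.

Lemma eucl_dist_triangle y x z : eucl_dist x z <= eucl_dist x y + eucl_dist y z.
Proof.
apply: eucl_dist_leP => t _.
have := height_le_dist t x y; have := height_le_dist t y z; lra.
Qed.

Lemma heightD t x y : height t (x + y) = height t x + height t y.
Proof. by rewrite /height/=; ring. Qed.
Lemma heightB t x y : height t (x - y) = height t x - height t y.
Proof. by rewrite /height/=; ring. Qed.
Lemma heightZ t a x : height t (a *: x) = a * height t x.
Proof. by rewrite /height/= /GRing.scale/=; ring. Qed.
Lemma height_circle t s : height t (circle_point s) = cos (t - s).
Proof. by rewrite /height/= cosB; ring. Qed.
Lemma heightDpi t x : height (t + pi) x = - height t x.
Proof. by rewrite /height cosDpi sinDpi; ring. Qed.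
Lemma heightD2pi t x : height (t + pi *+ 2) x = height t x.
Proof. by rewrite /height cosD2pi sinD2pi. Qed.

Lemma convex_setP (A : set plane) :
  convex_set A <-> forall x y a, A x -> A y -> 0 <= a <= 1 ->
    A (a *: x + (1 - a) *: y).
Proof.
split => [cA x y a Ax Ay /andP[a0 a1]|H].
  have := cA x y (Itv01 a0 a1); rewrite !inE => /(_ Ax Ay).
  by rewrite /conv/=.
move=> x y l; rewrite !inE => Ax Ay.
by have := H x y l%:num Ax Ay; apply; apply/andP; split.
Qed.

Lemma bounded_eucl_compact (K : set plane) r : closed K ->
  (forall x y, K x -> K y -> eucl_dist x y <= r) -> compact K.
Proof.
move=> clK Kr; have [->|/set0P[x Kx]] := eqVneq K set0; first exact: compact0.
have cB := compact_setX (@segment_compact _ (x.1 - r) (x.1 + r))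
  (@segment_compact _ (x.2 - r) (x.2 + r)).
apply: (subclosed_compact clK cB) => y Ky.
have := height_le_dist 0 x y; have := height_le_dist (pi / 2) x y.
have := height_le_dist 0 y x; have := height_le_dist (pi / 2) y x.
have := Kr x y Kx Ky; have := Kr y x Ky Kx.
rewrite /height cos0 sin0 cos_pihalf sin_pihalf !(mulr0, mulr1, addr0, add0r).
by split; rewrite /= in_itv/=; lra.
Qed.

Lemma continuous_height t : continuous (height t).
Proof.
move=> x; apply: cvgD; apply: cvgMl; first exact: cvg_fst.
exact: cvg_snd.
Qed.

Lemma diam_leP (K : set plane) (r : R) :
  (diam K <= r%:E)%E <-> forall x y, K x -> K y -> eucl_dist x y <= r.
Proof.
split=> [H x y Kx Ky|H].
  rewrite -lee_fin; apply: le_trans H; apply: ereal_sup_ubound.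
  by exists (x, y).
by apply: ge_ereal_sup => _ [[x y] [Kx Ky] <-]; rewrite lee_fin H.
Qed.

End PlaneGeometry.

(** * Area and reduction to approximation *)

Section Area.
Context {R : realType}.
Notation plane := (R * R)%type.
Notation mu := (@lebesgue_measure R).

Definition rescale (a b : R) : measurableTypeR R -> measurableTypeR R :=
  fun x => (x - b) / a.

Lemma measurable_rescale a b : measurable_fun setT (rescale a b).
Proof.
apply: continuous_measurable_fun => x.
by apply: cvgMl; apply: cvgB; [exact: cvg_id|exact: cvg_cst].
Qed.

(** The push-forward times [a^-1] agrees with Lebesgue measure on half-open intervals, which
    determine it. *)
Lemma lebesgue_measure_rescale (a b : R) (A : set R) : 0 < a -> measurable A ->
  mu (rescale a b @^-1` A) = (a%:E * mu A)%E.
Proof.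
move=> a0 mA; have ai0 : 0 <= a^-1 by rewrite invr_ge0 ltW.
pose m : {measure set (measurableTypeR R) -> \bar R} :=
  mscale (NngNum ai0) (pushforward mu (rescale a b)).
have E : mu A = m (measurable_rescale a b) A.
  apply: lebesgue_measure_unique => //= _ [[c d]] _ <-.
  rewrite /m /mscale/= /pushforward.
  rewrite (_ : _ @^-1` _ = `]a * c + b, a * d + b]%classic); last first.
    apply/seteqP; split => x /=;
      rewrite !in_itv/= /rescale ltr_pdivlMr// ler_pdivrMr//; lra.
  rewrite !lebesgue_measure_itv/= !lte_fin ltrD2r ltr_pM2l//.
  case: ifP => _; last by rewrite mule0.
  by rewrite -!EFinD -EFinM; congr EFin; field; rewrite gt_eqF.
by rewrite E /m /mscale/= muleA -EFinM divff ?gt_eqF// mul1e.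
Qed.

Lemma compact_measurable (K : set plane) : compact K ->
  measurable (K : set (measurableTypeR R * measurableTypeR R)).
Proof.
move=> cK; have clK : closed K := compact_closed (@norm_hausdorff _ _) cK.
(* Balls of the product norm are squares, hence measurable rectangles. Those of radius [1 / (n + 1)]
   with rational centre that meet [K] are countably many; since [K] is closed, their unions over all
   [n] intersect in [K]. *)
pose B (n : nat) (q : rat * rat) : set plane :=
  if `[< ball ((ratr q.1, ratr q.2) : plane) (n.+1%:R^-1) `&` K !=set0 >]
  then ball ((ratr q.1, ratr q.2) : plane) (n.+1%:R^-1) else set0.
suff -> : K = \bigcap_n \bigcup_(q in setT) B n q.
  apply: bigcapT_measurable => n; apply: countable_bigcupT_measurable.
    exact: countableP.
  move=> q; rewrite /B; case: ifP => // _.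
  rewrite (_ : ball _ _ = ball (ratr q.1 : R) (n.+1%:R^-1) `*` ball (ratr q.2 : R)
    (n.+1%:R^-1))//.
  by apply: measurableX; exact: measurable_ball.
apply/seteqP; split => [x Kx n _|x Hx].
  have n0 : 0 < n.+1%:R^-1 :> R by rewrite invr_gt0.
  have rat_near (c : R) : exists q : rat, ball (ratr q : R) n.+1%:R^-1 c.
    have [||r []] := @dense_rat R (ball c n.+1%:R^-1).
    - by exists c; exact: ballxx.
    - exact: ball_open.
    - by move=> /ball_sym br [q _ qr]; exists q; rewrite qr.
  have [[q1 H1] [q2 H2]] := (rat_near x.1, rat_near x.2).
  exists (q1, q2) => //; rewrite /B; case: asboolP => [_|[]]; first by split.
  by exists x; split => //; split.
apply: clK => U /nbhs_ballP[e/= e0 xeU].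
have [n ne] : exists n : nat, n.+1%:R^-1 < e / 2.
  have e20 : 0 < e / 2 by rewrite divr_gt0.
  have [n _ /(_ _ (leqnn n))] := near_infty_natSinv_lt (PosNum e20); by exists n.
have [q _] := Hx n I.
rewrite /B; case: asboolP => // -[y [qy Ky]] qx.
exists y; split => //; apply: xeU.
have /ball_sym qx' := qx.
by apply: le_ball (ball_triangle qx' qy); rewrite [e in _ <= e](splitr e) lerD ?ltW.
Qed.

Lemma area_ge0 (U : set plane) : (0 <= area U)%E.
Proof. exact: measure_ge0. Qed.

(** The inverse of [x -> a x + b]: enlarged copies are preimages under it, the form suited to
    push-forward measures. *)
Definition homothety (a : R) (b x : plane) : plane := a^-1 *: (x - b).

(** As in dimension one: the push-forward times [a^-2] has the right values on rectangles. *)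
Lemma area_homothety (a : R) (b : plane) (U : set plane) : 0 < a -> compact U ->
  area (homothety a b @^-1` U) = ((a ^+ 2)%:E * area U)%E.
Proof.
move=> a0 /compact_measurable mU.
pose f (x : measurableTypeR R * measurableTypeR R) :=
  (rescale a b.1 x.1, rescale a b.2 x.2).
have mf : measurable_fun setT f.
  by apply: measurable_fun_pair; apply: measurableT_comp => //; exact: measurable_rescale.
have ai0 : 0 <= a ^- 2 by rewrite invr_ge0 exprn_ge0 ?ltW.
pose m : {measure set (measurableTypeR R * measurableTypeR R) -> \bar R} :=
  mscale (NngNum ai0) (pushforward (mu \x mu)%E f).
have E : area U = m mf U.
  apply: product_measure_unique => // A B mA mB.
  rewrite /m /mscale/= /pushforward.
  change ((a ^- 2)%:E * (mu \x mu) ((rescale a b.1 @^-1` A) `*` (rescale a b.2 @^-1`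
    B)) = mu A * mu B)%E.
  transitivity ((a ^- 2)%:E * (mu (rescale a b.1 @^-1` A) * mu (rescale a b.2 @^-1`
    B)))%E.
    congr (_ * _)%E; apply: product_measure1E.
      by rewrite -[X in measurable X]setTI; exact: measurable_rescale.
    by rewrite -[X in measurable X]setTI; exact: measurable_rescale.
  rewrite !lebesgue_measure_rescale// muleACA muleA -!EFinM.
  by rewrite -expr2 !muleA -EFinM mulVf ?mul1e// expf_eq0/= gt_eqF.
rewrite E /m /mscale/= muleA -EFinM divff ?expf_eq0/= ?gt_eqF// mul1e.
rewrite /area /pushforward; congr ((_ \x _)%E _).
suff -> : f = homothety a b by [].
by apply/funext => x; rewrite /f /rescale mulrC [X in (_, X)]mulrC.
Qed.

End Area.

(** * Reduction of the area estimate to an approximation problem *)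

Section Reduction.
Context {R : realType}.
Notation plane := (R * R)%type.
Implicit Types (K U : set plane) (g : plane -> plane) (M : nat).

Lemma height_le_support K t x : compact K -> K x -> height t x <= support_fun K t.
Proof.
move=> cK Kx; apply: sup_ubound; last by exists x.
have : compact (height t @` K).
  apply: continuous_compact => //; apply: continuous_subspaceT.
  exact: continuous_height.
move=> /compact_bounded[M [_ /(_ (M + 1))]]; rewrite ltrDl ltr01 => /(_ isT) H.
by exists (M + 1) => _ [y Ky <-]; apply: le_trans (ler_norm _) _; apply: H; exists y.
Qed.

Lemma constant_width1_unit_diameter K : constant_width1 K -> unit_diameter_sets K.
Proof.
move=> [[[cK _] [x /interior_subset Kx]] wK]; split=> //; first by exists x.
apply/diam_leP => y z Ky Kz; apply: eucl_dist_leP => t _.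
have := height_le_support t cK Ky.
have := height_le_support (t + pi) cK Kz.
have := wK t; rewrite heightDpi; lra.
Qed.

Lemma eucl_dist_scale (c : plane) (a : R) (x : plane) : 0 <= a ->
  eucl_dist (c + a *: x) c = a * eucl_dist x 0.
Proof.
move=> a0; rewrite -[a in RHS](ger0_norm a0) -sqrtr_sqr /eucl_dist -sqrtrM ?sqr_ge0//=
  /GRing.scale/=.
by congr Num.sqrt; ring.
Qed.

Lemma eucl_distDr (z x y : plane) : eucl_dist (x + z) (y + z) = eucl_dist x y.
Proof. by rewrite /eucl_dist/=; congr Num.sqrt; ring. Qed.

Lemma disk_unit_diameter : unit_diameter_sets (disk : set plane).
Proof.
have dd (x y : plane) : disk x -> disk y -> eucl_dist x y <= 1.
  rewrite /disk/= => dx; rewrite eucl_distC => dy.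
  by have := eucl_dist_triangle (0, 0) x y; lra.
split; [ | |exact/diam_leP].
  by exists (0, 0); rewrite /disk/= /eucl_dist/= subrr expr0n addr0 sqrtr0 invr_ge0.
apply: bounded_eucl_compact dd.
rewrite (_ : disk = \bigcap_(t in setT) [set x : plane | height t x <= 2^-1]).
  apply: closed_bigI => t _; apply: closed_comp (@closed_le _ _) => x _.
  exact: continuous_height.
apply/seteqP; split=> [x dx t _|x Hx].
  apply: le_trans dx; have := height_le_dist t x (0, 0).
  by rewrite {2}/height/= !mul0r addr0 subr0.
apply: eucl_dist_leP => t _; have := Hx t I.
by rewrite {3}/height/= !mul0r addr0 subr0.
Qed.

Lemma universal_cover_sub M : universal_cover `<=` convex_cover (@finite_arc_family R M).
Proof.
move=> U [ccU HU]; split=> // K HK; apply: HU.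
case: HK => [->|[m _ [wK _]]]; first exact: disk_unit_diameter.
exact: constant_width1_unit_diameter.
Qed.

Lemma Lambda_le_aLeb M : (Lambda R M <= a_Leb R)%E.
Proof.
apply: ereal_inf_le_tmp; apply: image_subset; exact: universal_cover_sub.
Qed.

Lemma Lambda_ge0 M : (0 <= Lambda R M)%E.
Proof. by apply: le_ereal_inf_tmp => _ [U _ <-]; exact: area_ge0. Qed.

(** A set of diameter at most 1 that contains the origin lies in the square [[-1, 1]^2]. The bound
    gives finiteness and later turns a relative error into an absolute one. *)
Lemma aLeb_le4 : (a_Leb R <= 4%:E)%E.
Proof.
pose I : set R := `[-1, 1]%classic; pose V : set plane := I `*` I.
have -> : 4%:E = area V.
  have mI : lebesgue_measure I = 2%:E.
    rewrite lebesgue_measure_itv/= lte_fin ifT; last by lra.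
    by rewrite -EFinB; congr EFin; ring.
  transitivity (lebesgue_measure I * lebesgue_measure I)%E.
    by rewrite mI -EFinM; congr EFin; ring.
  by symmetry; apply: product_measure1E; exact: measurable_itv.
apply: ereal_inf_lbound; exists V => //; split; first split.
- by apply: compact_setX; exact: segment_compact.
- apply/convex_setP => x y a.
  rewrite /V /I/= !in_itv/= => -[/andP[? ?] /andP[? ?]] [/andP[? ?] /andP[? ?]]
    /andP[a0 a1].
  have b0 : 0 <= 1 - a by rewrite subr_ge0.
  by rewrite /GRing.scale/=; split; apply/andP; split; nra.
- move=> K [[x0 Kx0] _ /diam_leP dK].
  exists (fun x => x - x0) => [x y|_ [x Kx <-]]; first exact: eucl_distDr.
  have := dK _ _ Kx Kx0; have := dK _ _ Kx0 Kx.
  have := height_le_dist 0 x x0; have := height_le_dist (pi / 2) x x0.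
  have := height_le_dist 0 x0 x; have := height_le_dist (pi / 2) x0 x.
  rewrite /height cos0 sin0 cos_pihalf sin_pihalf !(mulr0, mulr1, addr0, add0r).
  by rewrite /V /I/= !in_itv/=; split; lra.
Qed.

(** Surjectivity makes the image of the disk a full disk. The images [b] and [c] of the coordinate
    vectors are orthonormal, [x] has the inner products of [y - g 0] with them as coordinates, and
    [w = g x - y] is orthogonal to both, hence 0. *)
Lemma isometry_onto g (y : plane) : euclidean_isometry g -> exists x, g x = y.
Proof.
move=> gI; have gsq x z : (( g x).1 - (g z).1) ^+ 2 + ((g x).2 - (g z).2) ^+ 2 =
    (x.1 - z.1) ^+ 2 + (x.2 - z.2) ^+ 2 by rewrite -!eucl_dist_sqr gI.
have := gsq (1, 0) (0, 0); have := gsq (0, 1) (0, 0); have := gsq (1, 0) (0, 1).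
set A := g (0, 0); set B := g (1, 0); set C := g (0, 1) => /= E1 E2 E3.
pose x := ((y.1 - A.1) * (B.1 - A.1) + (y.2 - A.2) * (B.2 - A.2),
           (y.1 - A.1) * (C.1 - A.1) + (y.2 - A.2) * (C.2 - A.2)).
exists x; move: (gsq x (0, 0)) (gsq x (1, 0)) (gsq x (0, 1)) => /=.
rewrite -/A -/B -/C; set P := g x => F1 F2 F3.
pose b1 := B.1 - A.1; pose b2 := B.2 - A.2.
pose c1 := C.1 - A.1; pose c2 := C.2 - A.2.
pose w1 := P.1 - y.1; pose w2 := P.2 - y.2.
have G1 : w1 * b1 + w2 * b2 = 0 by rewrite /w1 /w2 /b1 /b2; nra.
have G2 : w1 * c1 + w2 * c2 = 0 by rewrite /w1 /w2 /c1 /c2; nra.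
have bc : b1 * c1 + b2 * c2 = 0 by rewrite /b1 /b2 /c1 /c2; nra.
have bb : b1 ^+ 2 + b2 ^+ 2 = 1 by rewrite /b1 /b2; nra.
have cc : c1 ^+ 2 + c2 ^+ 2 = 1 by rewrite /c1 /c2; nra.
have det : (b1 * c2 - b2 * c1) ^+ 2 = 1.
  have -> : (b1 * c2 - b2 * c1) ^+ 2 = (b1 ^+ 2 + b2 ^+ 2) * (c1 ^+ 2 + c2 ^+ 2) - (b1
    * c1 + b2 * c2) ^+ 2 by ring.
  by rewrite bb cc bc; ring.
have detN0 : b1 * c2 - b2 * c1 != 0 by apply/eqP => d0; move: det;
  rewrite d0 expr0n/= => /eqP; rewrite eq_sym oner_eq0.
have H1 : w1 = 0.
  apply: (mulIf detN0); rewrite mul0r.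
  have -> : w1 * (b1 * c2 - b2 * c1) = (w1 * b1 + w2 * b2) * c2 - (w1 * c1 + w2 * c2) *
    b2 by ring.
  by rewrite G1 G2; ring.
have H2 : w2 = 0.
  apply: (mulIf detN0); rewrite mul0r.
  have -> : w2 * (b1 * c2 - b2 * c1) = (w1 * c1 + w2 * c2) * b1 - (w1 * b1 + w2 * b2) *
    c1 by ring.
  by rewrite G1 G2; ring.
by apply/eqP; rewrite -pair_eqE; apply/andP; split; rewrite -subr_eq0; apply/eqP.
Qed.

Definition approximable (eps : R) (F : set (set plane)) K :=
  exists2 K', F K' & forall x, K x -> exists2 y, K' y & eucl_dist x y <= eps.

Lemma aLeb_le_of_approx eps M : 0 < eps ->
  (forall K, unit_diameter_sets K -> approximable eps (finite_arc_family M) K) ->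
  (a_Leb R <= ((1 + 2 * eps) ^+ 2)%:E * Lambda R M)%E.
Proof.
move=> e0 Happ; set r := 1 + 2 * eps; have r0 : 0 < r by rewrite /r; lra.
rewrite -lee_pdivrMl ?exprn_gt0//; apply: le_ereal_inf_tmp => _ [U [[cU vU] HU] <-].
rewrite lee_pdivrMl ?exprn_gt0//.
have [g0 g0I g0U] := HU disk (or_introl erefl).
(* The translation is chosen so that [x -> r x + b] fixes [c], the centre of the covered disk. *)
pose c := g0 (0, 0); pose b : plane := - (2 * eps) *: c.
rewrite -(area_homothety b)//; apply: ereal_inf_lbound.
exists (homothety r b @^-1` U) => //; split; first split.
- have -> : homothety r b @^-1` U = (fun x => r *: x + b) @` U.
    apply/seteqP; split=> [x Ux|_ [x Ux <-]].
      by exists (homothety r b x) => //; rewrite scalerA divff ?gt_eqF// scale1r subrK.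
    by rewrite /= /homothety addrK scalerA mulVf ?gt_eqF// scale1r.
  apply: continuous_compact => //; apply: continuous_subspaceT => x.
  by apply: cvgD; [apply: cvgZr; exact: cvg_id|exact: cvg_cst].
- apply/convex_setP => x y a Ux Uy a01.
  rewrite /= (_ : homothety r b _ = a *: homothety r b x + (1 - a) *: homothety r b y).
    by move/convex_setP : vU; apply.
  rewrite /homothety !scalerA ![_ * r^-1]mulrC -!scalerA -scalerDr; congr (_ *: _).
  by rewrite !scalerBr addrACA -opprD -scalerDl [a + _]addrC subrK scale1r.
- move=> K /Happ[K' FK' KK']; have [g gI gU] := HU K' FK'.
  exists g => // _ [x Kx <-]; have [y Ky xy] := KK' _ Kx.
  have Uy : U (g y) by apply: gU; exists y.
  (* As [g x - g y] has length at most [eps], dividing it by [2 eps] leads to a point of the disk of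
     radius 1/2 around [c]. *)
  have Uc : U (c + (2 * eps)^-1 *: (g x - g y)).
    have [z zE] := isometry_onto (c + (2 * eps)^-1 *: (g x - g y)) g0I.
    rewrite -zE; apply: g0U; exists z => //; rewrite /disk/= -g0I zE.
    rewrite eucl_dist_scale ?invr_ge0; last by lra.
    rewrite -(eucl_distDr (g y)) subrK add0r gI.
    by rewrite ler_pdivrMl ?mulr_gt0//; lra.
  have := convex_setP U; move=> [/(_ vU _ _ r^-1 Uy Uc) H _].
  (* The map [x -> r x + b] sends this convex combination to [g x]. *)
  have : U (r^-1 *: g y + (1 - r^-1) *: (c + (2 * eps)^-1 *: (g x - g y))).
    apply: H; rewrite invr_ge0 (ltW r0)/= invf_le1// /r; lra.
  congr U; rewrite /homothety /b.
  rewrite (_ : 1 - r^-1 = r^-1 * (2 * eps)); last first.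
    by rewrite /r; field; rewrite -/r gt_eqF.
  rewrite -scalerA -scalerDr; congr (_ *: _).
  rewrite scalerDr scalerA divff ?mulf_neq0 ?gt_eqF// scale1r.
  by rewrite scaleNr opprK addrCA [g y + _]addrC subrK addrC.
Qed.

End Reduction.

(** * Helly's theorem and diameters in prescribed directions *)

Section Helly.
Context {R : realType}.
Notation plane := (R * R)%type.
Implicit Types (x y z : plane) (C : set plane).

Lemma convex_combination (I : Type) C (w : I -> R) (p : I -> plane) (s : seq I) :
  convex_set C -> (forall i, 0 <= w i) -> (forall i, w i != 0 -> C (p i)) ->
  0 < \sum_(i <- s) w i ->
  C ((\sum_(i <- s) w i)^-1 *: \sum_(i <- s) w i *: p i).
Proof.
move=> /convex_setP vC w0 wC.
(* The weights of a tail of the list may all vanish, hence the alternative in the induction. *)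
suff: (\sum_(i <- s) w i = 0 /\ \sum_(i <- s) w i *: p i = 0) \/
  0 < \sum_(i <- s) w i /\ C ((\sum_(i <- s) w i)^-1 *: \sum_(i <- s) w i *: p i).
  by case=> [[-> _]|[_ //]]; rewrite ltxx.
elim: s => [|a s IH]; first by left; rewrite !big_nil.
rewrite !big_cons; have [wa0|waN0] := eqVneq (w a) 0.
  by rewrite wa0 scale0r !add0r.
have wa : 0 < w a by rewrite lt_def waN0 w0.
right; case: IH => [[-> ->]|[W0 CW]].
  by rewrite !addr0 wa scalerA mulVf// scale1r; split => //; exact: wC.
set W := \sum_(i <- s) w i in W0 CW *; set S := \sum_(i <- s) _ in CW *.
have aW : 0 < w a + W by rewrite addr_gt0.
split=> //.
have := vC _ _ (w a / (w a + W)) (wC _ waN0) CW.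
rewrite divr_ge0 ?(ltW wa) ?(ltW aW)// ler_pdivrMr// mul1r lerDl (ltW W0).
move=> /(_ isT); congr C; rewrite scalerDr !scalerA; congr (_ *: _ + _ *: _).
  by rewrite mulrC.
by field; rewrite !gt_eqF.
Qed.

(** The rows [(1, x, y)] of the four points form a 4 x 3 matrix, which has a nontrivial left
    kernel. *)
Lemma affine_dependence (p : 'I_4 -> plane) : exists l : 'I_4 -> R,
  [/\ exists i, l i != 0, \sum_i l i = 0 & \sum_i l i *: p i = 0].
Proof.
pose A : 'M[R]_(4, 3) := \matrix_(i, j) [:: 1; (p i).1; (p i).2]`_j.
have /rowV0Pn[v /sub_kermxP vA v0] : kermx A != 0.
  by rewrite -mxrank_eq0 mxrank_ker -lt0n subn_gt0 ltnS rank_leq_col.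
have vE (j : 'I_3) : \sum_i v 0 i * [:: 1; (p i).1; (p i).2]`_j = 0.
  have /matrixP /(_ 0 j) := vA; rewrite !mxE => E.
  by rewrite -[RHS]E; apply: eq_bigr => i _; rewrite !mxE.
exists (v 0); split.
- by apply/existsP; apply: contraNT v0 => /existsPn H; apply/eqP/rowP => i;
  rewrite mxE; apply/eqP; have := H i; rewrite negbK.
- by have := vE 0; under eq_bigr do rewrite mulr1.
- apply/eqP; rewrite -pair_eqE; apply/andP; split; apply/eqP.
    have := vE (inord 1); rewrite inordK//= => E.
    by rewrite (raddf_sum fst).
  have := vE (inord 2); rewrite inordK//= => E.
  by rewrite (raddf_sum snd).
Qed.

(* Radon's argument: the positive and the negative part of an affine
   dependence between the four points give the same point. *)
Lemma helly4 (C : 'I_4 -> set plane) (p : 'I_4 -> plane) :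
  (forall i, convex_set (C i)) -> (forall i j, i != j -> C j (p i)) ->
  exists x, forall i, C i x.
Proof.
move=> vC Cp; have [l [[i0 li0] l0 lp0]] := affine_dependence p.
pose w i := Num.max (l i) 0; pose v i := Num.max (- l i) 0.
have lE i : l i = w i - v i by rewrite /w /v; have [] := leP (l i) 0;
  have [] := leP (- l i) 0; lra.
have w0 i : 0 <= w i by rewrite /w le_max lexx orbT.
have v0 i : 0 <= v i by rewrite /v le_max lexx orbT.
have wv : \sum_i w i = \sum_i v i.
  by apply/eqP; rewrite -subr_eq0 -sumrB -[X in _ == X]l0; apply/eqP;
    apply: eq_bigr => i _; rewrite lE.
have wvp : \sum_i w i *: p i = \sum_i v i *: p i.
  by apply/eqP; rewrite -subr_eq0 -sumrB -[X in _ == X]lp0; apply/eqP;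
    apply: eq_bigr => i _; rewrite lE scalerBl.
have W0 : 0 < \sum_i w i.
  rewrite lt_def sumr_ge0// andbT; apply: contra_neq li0 => W0.
  have wi := psumr_eq0P (fun i _ => w0 i) W0 (i := i0) isT.
  rewrite wv in W0; have vi := psumr_eq0P (fun i _ => v0 i) W0 (i := i0) isT.
  by rewrite lE wi vi subrr.
exists ((\sum_i w i)^-1 *: \sum_i w i *: p i) => j.
have [lj|lj] := leP (l j) 0.
  apply: convex_combination => // i wi; apply: Cp.
  by apply: contra_neq wi => ->; rewrite /w; apply/max_idPr.
rewrite wvp wv; apply: convex_combination => //; last by rewrite -wv.
move=> i vi; apply: Cp.
by apply: contra_neq vi => ->; rewrite /v; apply/max_idPr; lra.
Qed.

(** Induction on the list, each set of the tail being intersected with the first one; that any three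
    of these intersections meet is the case of four sets. *)
Lemma helly (T : eqType) (C : T -> set plane) (s : seq T) :
  (forall i, convex_set (C i)) ->
  (forall i j k, i \in s -> j \in s -> k \in s ->
     exists x, [/\ C i x, C j x & C k x]) ->
  exists x, forall i, i \in s -> C i x.
Proof.
elim: s C => [|a s IH] C vC C3; first by exists 0.
(* The conclusion for [a] is read off from an intersection of [C b] with [C a], so an empty tail is
   treated apart. *)
have [->|[b bs]] : s = [::] \/ exists b, b \in s.
  by case: (s) => [|b r]; [left|right; exists b; rewrite mem_head].
  have [x [Cx _ _]] := C3 a a a (mem_head _ _) (mem_head _ _) (mem_head _ _).
  by exists x => i; rewrite inE => /eqP ->.
have [||x Hx] := IH (fun i => C i `&` C a).
- move=> i; apply/convex_setP => x y c [xi xa] [yi ya] c01.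
  by split; [have /convex_setP := vC i|have /convex_setP := vC a]; apply.
- move=> i j k si sj sk.
  have mem c : c \in s -> c \in a :: s by rewrite inE orbC => ->.
  have ma := mem_head a s.
  (* Each of the four points lies in all sets but one: [x0] omits [i], [x1] omits [j], [x2] omits
     [k] and [x3] omits [a]. *)
  have [x0 [? ? ?]] := C3 _ _ _ (mem _ sj) (mem _ sk) ma.
  have [x1 [? ? ?]] := C3 _ _ _ (mem _ si) (mem _ sk) ma.
  have [x2 [? ? ?]] := C3 _ _ _ (mem _ si) (mem _ sj) ma.
  have [x3 [? ? ?]] := C3 _ _ _ (mem _ si) (mem _ sj) (mem _ sk).
  have [||x Hx] := @helly4 (fun m : 'I_4 => C (nth a [:: i; j; k; a] m))
    (fun m => nth x0 [:: x0; x1; x2; x3] m).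
  + by case=> -[|[|[|[|]]]].
  + by case=> -[|[|[|[|]]]] //= ? [[|[|[|[|]]]] //= ?] //.
  have X0 := Hx 0; have X1 := Hx 1; have X2 := Hx (inord 2); have X3 := Hx (inord 3).
  rewrite !inordK//= in X0 X1 X2 X3.
  by exists x.
exists x => i; rewrite inE => /orP[/eqP ->|/Hx[]//].
by have [] := Hx _ bs.
Qed.

End Helly.

(** * Unit diameters in prescribed directions, and finite nets *)

Section DirectionalCompletion.
Context {R : realType}.
Notation plane := (R * R)%type.
Implicit Types (x y z : plane) (s : seq plane) (t : R).

Definition spread1 s := forall x y, x \in s -> y \in s -> eucl_dist x y <= 1.

Lemma eucl_dist_xx x : eucl_dist x x = 0.
Proof. by rewrite /eucl_dist !subrr expr0n addr0 sqrtr0. Qed.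

Lemma eucl_dist_circle_point x t : eucl_dist x (x + circle_point t) = 1.
Proof.
rewrite /eucl_dist/= (_ : _ + _ = 1) ?sqrtr1//.
by rewrite -[RHS](cos2Dsin2 t); ring.
Qed.

Lemma convex_eucl_ball x (r : R) : convex_set [set y | eucl_dist x y <= r].
Proof.
apply/convex_setP => y z a /= yr zr /andP[a0 a1]; apply: eucl_dist_leP => t _.
rewrite heightD !heightZ.
have := height_le_dist t x y; have := height_le_dist t x z; nra.
Qed.

(* Any three of the balls of radius 1 around the points of s and of their
   translates by - u meet trivially, so Helly's theorem applies. *)
Lemma add_diameter s t : spread1 s -> exists y, spread1 [:: y, y + circle_point t & s].
Proof.
move=> s1; set u := circle_point t.
pose C (c : plane * bool) := [set y | eucl_dist c.1 (y + if c.2 then u else 0) <= 1].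
have [||y Hy] := helly (C := C) (s := [seq (x, b) | x <- s, b <- [:: true; false]]).
- move=> [x b]; apply/convex_setP => y z a.
  rewrite /C/= => Hy Hz a01.
  have -> : a *: y + (1 - a) *: z + (if b then u else 0) =
      a *: (y + if b then u else 0) + (1 - a) *: (z + if b then u else 0).
    by rewrite !scalerDr addrACA -[in RHS]scalerDl [a + _]addrC subrK scale1r.
  by have /convex_setP := convex_eucl_ball (x := x) (r := 1); apply.
- move=> _ _ _ /allpairsPdep[x [a [xs _ ->]]] /allpairsPdep[y [b [ys _ ->]]]
  /allpairsPdep[z [c [zs _ ->]]].
  have xu w : eucl_dist w (w + u) <= 1 by rewrite eucl_dist_circle_point.
  have xNu w : eucl_dist w (w - u) <= 1.
    by rewrite -(eucl_distDr u) subrK eucl_distC eucl_dist_circle_point.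
  (* If the flags differ, the witness is the point with the minority flag, moved by [- u] when the
     majority flag is [true]: the majority conditions then compare points of [s], and the third one
     compares a point with its translate by [u] or [- u]. *)
  rewrite /C/=; case: a; case: b; case: c.
  + by exists (x - u); rewrite subrK; split; apply: s1.
  + by exists (z - u); rewrite subrK addr0; split => //; apply: s1.
  + by exists (y - u); rewrite subrK addr0; split => //; apply: s1.
  + by exists x; rewrite addr0; split => //; apply: s1.
  + by exists (x - u); rewrite subrK addr0; split => //; apply: s1.
  + by exists y; rewrite addr0; split => //; apply: s1.
  + by exists z; rewrite addr0; split => //; apply: s1.
  + by exists x; rewrite addr0; split => //; apply: s1.
have {}Hy x b : x \in s -> eucl_dist x (y + if b then u else 0) <= 1.
  by move=> xs; apply: (Hy (x, b)); apply/allpairsPdep; exists x, b; case: b.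
have y0 x : x \in s -> eucl_dist x y <= 1.
  by move=> xs; have := Hy x false xs; rewrite addr0.
have yu x : x \in s -> eucl_dist x (y + u) <= 1 by exact: (Hy x true).
exists y => a b; rewrite !inE => /or3P[/eqP ->|/eqP ->|sa] /or3P[/eqP ->|/eqP ->|sb];
  first [by rewrite eucl_dist_xx ler01 | by rewrite eucl_dist_circle_point
  | by rewrite eucl_distC eucl_dist_circle_point | exact: s1 | exact: y0 | exact: yu
  | by rewrite eucl_distC y0 | by rewrite eucl_distC yu].
Qed.

Lemma add_diameters s (f : nat -> R) (N : nat) : spread1 s ->
  exists s', [/\ {subset s <= s'}, spread1 s' &
    forall i, (i < N)%N -> exists2 y, y \in s' & y + circle_point (f i) \in s'].
Proof.
move=> s1; elim: N => [|N [s' [ss' s'1 IH]]]; first by exists s; split.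
have [y ys'] := add_diameter (f N) s'1.
exists [:: y, y + circle_point (f N) & s']; split => //.
  by move=> x /ss' xs'; rewrite !inE xs' !orbT.
move=> i; rewrite ltnS leq_eqVlt => /orP[/eqP ->|/IH[z zs zs']].
  by exists y; rewrite !inE eqxx ?orbT.
by exists z; rewrite !inE ?zs ?zs' !orbT.
Qed.

Lemma finite_net (K : set plane) (d : R) : compact K -> 0 < d ->
  exists s : seq plane, (forall x, x \in s -> K x) /\
    forall x, K x -> exists2 y, y \in s & eucl_dist x y <= d.
Proof.
move=> cK d0.
(* Half of [d], because the balls are those of the maximum norm and the Euclidean distance is at
   most the sum of the two coordinate differences. *)
have e0 : 0 < d / 2 by rewrite divr_gt0.
pose T : ptopologicalType :=
  HB.pack plane (Topological.on plane) (Pointed.on plane).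
have : finite_subset_cover K (fun x => ball x (d / 2)) K.
  move: cK; rewrite -[@compact _]/(@compact T) (@compact_cover T); apply.
    by move=> x _; exact: ball_open.
  by move=> x Kx; exists x => //; exact: ballxx.
move=> [F FK KF]; exists (finmap.enum_fset F); split => [x xF|x Kx].
  by have := FK x xF; rewrite inE.
have [y /= yF [b1 b2]] := KF x Kx; exists y => //.
apply: eucl_dist_leP => t _; rewrite /height.
move: b1 b2; rewrite /ball/= => b1 b2.
have := cos_max t; have := sin_max t.
move: b1 b2; rewrite !ltr_norml !ler_norml => /andP[? ?] /andP[? ?] /andP[? ?] /andP[? ?].
have : (x.1 - y.1) * cos t <= d / 2 by nra.
have : (x.2 - y.2) * sin t <= d / 2 by nra.
lra.
Qed.

End DirectionalCompletion.

(** * Bodies with prescribed curvature arcs *)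

Section Sweep.
Context {R : realType}.
Notation plane := (R * R)%type.
Implicit Types (G : R -> R) (s t f : R).

Lemma ler_cos_0pi (x y : R) : 0 <= x -> x <= y -> y <= pi -> cos y <= cos x.
Proof.
move=> x0; rewrite le_eqVlt => /predU1P[->//|xy] ypi.
by apply/ltW; rewrite ltr_cos ?in_itv/= ?x0 ?ypi//=; lra.
Qed.

Lemma ler_cos_pi2pi (x y : R) : pi <= x -> x <= y -> y <= pi *+ 2 -> cos x <= cos y.
Proof.
move=> px xy; rewrite mulr2n => y2.
have E z : cos z = cos (pi + pi - z) :> R.
  by rewrite -mulr2n addrC cosD2pi cosN.
by rewrite (E x) (E y); apply: ler_cos_0pi; lra.
Qed.

Variables (n : nat) (tau : nat -> R).

(* Along the boundary of a body whose radius of curvature is 1 on the odd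
   intervals [tau k, tau k.+1] and 0 on the other ones, the contact point moves
   by [(sweep cos s, sweep sin s)] between the normal angles 0 and s. *)
Definition sweep G s : R :=
  \sum_(k < n.*2 | odd k) (G (Num.min s (tau k.+1)) - G (Num.min s (tau k))).

Hypothesis tau0 : tau 0 = 0.
Hypothesis tau_lt : forall k, (k < n.*2)%N -> tau k < tau k.+1.
Hypothesis tauDpi : forall k, (k <= n)%N -> tau (n + k) = tau k + pi.
Hypothesis n_odd : odd n.

Lemma tau_mono i j : (i < j)%N -> (j <= n.*2)%N -> tau i < tau j.
Proof.
elim: j => // j IH; rewrite ltnS leq_eqVlt => /predU1P[->|ij] jn; first exact: tau_lt.
by apply: lt_trans (tau_lt _) => //; apply: IH => //; exact: ltnW.
Qed.

Lemma tau_le i j : (i <= j)%N -> (j <= n.*2)%N -> tau i <= tau j.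
Proof. by rewrite leq_eqVlt => /predU1P[->//|ij] jn; apply/ltW/tau_mono. Qed.

Lemma tau_ge0 k : (k <= n.*2)%N -> 0 <= tau k.
Proof. by move=> kn; rewrite -tau0 tau_le. Qed.

Lemma tau_n : tau n = pi.
Proof. by have := tauDpi (leq0n n); rewrite addn0 tau0 add0r. Qed.

Lemma tau_2n : tau n.*2 = pi *+ 2.
Proof. by rewrite -addnn tauDpi// tau_n mulr2n. Qed.

(** From [s] to [t] each odd interval contributes the increment of [G] over its part in [[s, t]]. *)
Lemma sweep_le G s t : s <= t ->
  (forall x y, s <= x -> x <= y -> y <= t -> G x <= G y) -> sweep G s <= sweep G t.
Proof.
move=> st mG; apply: ler_sum => k _.
have ab := tau_lt (ltn_ord k); move: (tau k) (tau k.+1) ab => a b ab.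
have [sa|as_] := leP s a.
  rewrite (min_idPl _) ?(le_trans sa (ltW ab))// subrr subr_ge0.
  apply: mG; first by rewrite le_min st sa.
    by rewrite le_min !ge_min lexx (ltW ab) orbT.
  by rewrite ge_min lexx.
rewrite [Num.min t a](min_idPr _) ?lerD2r; last by lra.
have [sb|bs] := leP s b.
  by apply: mG; rewrite // ?le_min ?st ?sb// ge_min lexx.
by rewrite [Num.min t b](min_idPr _)//; lra.
Qed.

Lemma sweep_ge G s t : s <= t ->
  (forall x y, s <= x -> x <= y -> y <= t -> G y <= G x) -> sweep G t <= sweep G s.
Proof.
move=> st mG; rewrite -lerN2 -!sumrN.
have E r : \sum_(k < n.*2 | odd k) - (G (Num.min r (tau k.+1)) - G (Num.min r (tau k))) =
  sweep (fun x => - G x) r by apply: eq_bigr => k _; rewrite opprD.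
by rewrite !E; apply: sweep_le => // x y sx xy yt; rewrite lerN2; exact: mG.
Qed.

Lemma sweep_lin (a b : R) G G' s :
  sweep (fun x => a * G x + b * G' x) s = a * sweep G s + b * sweep G' s.
Proof.
rewrite /sweep !mulr_sumr -big_split/=; apply: eq_bigr => k _; ring.
Qed.

Lemma sweep0 G : sweep G 0 = 0.
Proof.
apply: big1 => k _; rewrite !(min_idPl _) ?subrr//.
  by apply: tau_ge0; apply: ltnW.
by apply: tau_ge0.
Qed.

Lemma sweep_le_pi G s : s <= pi ->
  sweep G s = \sum_(k < n | odd k) (G (Num.min s (tau k.+1)) - G (Num.min s (tau k))).
Proof.
move=> spi; rewrite /sweep -addnn big_split_ord/= [X in _ + X]big1 ?addr0// => k _.
have := ltn_ord k => kn.
rewrite -addnS !tauDpi ?(ltnW kn)// !(min_idPl _) ?subrr//.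
  by apply: (le_trans spi); rewrite lerDr tau_ge0// -addnn;
    apply: leq_trans (ltnW kn) (leq_addl _ _).
by apply: (le_trans spi); rewrite lerDr tau_ge0// -addnn;
  apply: leq_trans kn (leq_addl _ _).
Qed.

(** As [n] is odd, the shift by [pi] exchanges odd and even intervals. The even intervals up to [s]
    contribute the total increment [G s - G 0] minus the odd part, and the sign changes because [G]
    is antiperiodic. *)
Lemma sweepDpi G s : (forall x, G (x + pi) = - G x) -> 0 <= s <= pi ->
  sweep G (s + pi) = sweep G pi - (G s - G 0) + sweep G s.
Proof.
move=> GN /andP[s0 spi]; rewrite (sweep_le_pi _ spi) (sweep_le_pi _ (lexx _)).
rewrite /sweep -addnn big_split_ord/=; rewrite -addrA; congr (_ + _).
  apply: eq_bigr => k _; have kn := ltn_ord k.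
  have tpi : tau k.+1 <= pi by rewrite -tau_n tau_le// -addnn leq_addl.
  have tpi' : tau k <= pi by rewrite -tau_n tau_le ?(ltnW kn)// -addnn leq_addl.
  by rewrite !(min_idPr _)//; lra.
have tel : \sum_(k < n) (G (Num.min s (tau k.+1)) - G (Num.min s (tau k))) = G s - G 0.
  rewrite -(big_mkord xpredT (fun k => G (Num.min s (tau k.+1)) - G (Num.min s (tau k)))).
  by rewrite telescope_sumr// tau_n tau0 (min_idPl _)// (min_idPr _).
move: tel; rewrite (bigID (fun k : 'I_n => odd k))/= => <-.
rewrite opprD addrAC addNr add0r -sumrN.
apply: eq_big => k; first by rewrite oddD n_odd.
move=> _; have kn := ltn_ord k.
rewrite -addnS !tauDpi// ?(ltnW kn)//.
by rewrite -!addr_minl !GN; ring.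
Qed.

End Sweep.

(** * The body of constant width bounded by the swept curve *)

Section SweptBody.
Context {R : realType}.
Notation plane := (R * R)%type.
Implicit Types (s t f : R) (x : plane).

Variables (x0 : plane) (n : nat) (tau : nat -> R).
Notation S := (sweep n tau).

Hypothesis tau0 : tau 0 = 0.
Hypothesis tau_lt : forall k, (k < n.*2)%N -> tau k < tau k.+1.
Hypothesis tauDpi : forall k, (k <= n)%N -> tau (n + k) = tau k + pi.
Hypothesis n_odd : odd n.
(** The closing condition: over a half turn the contact point moves by [(-1, 0)], to the other end
    of the unit diameter in direction 0. *)
Hypothesis sweep_cos_pi : S cos pi = -1.
Hypothesis sweep_sin_pi : S sin pi = 0.

Definition contact s : plane := x0 + (S cos s, S sin s).

Lemma height_contact f s :
  height f (contact s) = height f x0 + S (fun r => cos (f - r)) s.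
Proof.
rewrite heightD; congr (_ + _).
rewrite /height/= mulrC [X in _ + X]mulrC -sweep_lin.
by congr (sweep _ _ _ _); apply/funext => r; rewrite cosB.
Qed.

Lemma contact0 : contact 0 = x0.
Proof. by rewrite /contact !sweep0// -[(0, 0)]/(0 : plane) addr0. Qed.

Lemma contactDpi s : 0 <= s <= pi -> contact (s + pi) = contact s - circle_point s.
Proof.
move=> s0; rewrite /contact !sweepDpi//; [|exact: sinDpi|exact: cosDpi].
rewrite sweep_cos_pi sweep_sin_pi sin0 cos0.
by apply: injective_projections => /=; ring.
Qed.

Lemma contact2pi : contact (pi *+ 2) = x0.
Proof.
rewrite mulr2n contactDpi ?pi_ge0 ?lexx// -{1}[pi]add0r contactDpi ?lexx ?pi_ge0//.
rewrite contact0 /circle_point cospi sinpi cos0 sin0.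
by apply: injective_projections => /=; ring.
Qed.

Lemma sweep2pi f : S (fun r => cos (f - r)) (pi *+ 2) = 0.
Proof. by have := height_contact f (pi *+ 2); rewrite contact2pi; lra. Qed.

(** Along the shorter way round the circle from [s] to [f], the function [cos (f - r)] of [r]
    increases, and the swept height with it. If this way passes through angle 0, the comparison goes
    through the value 0, which the sweep takes both at 0 and at [2 pi]. *)
Lemma height_contact_le s f : 0 <= s <= pi *+ 2 -> 0 <= f <= pi *+ 2 ->
  height f (contact s) <= height f (contact f).
Proof.
rewrite mulr2n => /andP[s0 s2] /andP[f0 f2]; rewrite !height_contact lerD2l.
have E0 : S (fun r => cos (f - r)) 0 = 0 by exact: sweep0.
have E2 := sweep2pi f; rewrite mulr2n in E2.
have cos_sym r : cos (f - r) = cos (r - f) by rewrite -cosN opprB.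
have [sf|fs] := leP s f; have [d|d] := leP `|f - s| pi.
- apply: sweep_le => // x y sx xy yf; apply: ler_cos_0pi; move: d; rewrite ler_norml; lra.
- move: d; rewrite ger0_norm ?subr_ge0// => d.
  apply: (@le_trans _ _ 0).
    rewrite -E0; apply: sweep_ge => // x y x0' xy ys; apply: ler_cos_pi2pi;
      rewrite ?mulr2n; lra.
  rewrite -E2; apply: sweep_ge => // x y fx xy y2; rewrite !cos_sym.
  by apply: ler_cos_0pi; lra.
- have {}fs := ltW fs; apply: sweep_ge => // x y sx xy yf; rewrite !cos_sym.
  by apply: ler_cos_0pi; move: d; rewrite ler_norml; lra.
- have {}fs := ltW fs; move: d; rewrite ler0_norm ?subr_le0// opprB => d.
  apply: (@le_trans _ _ 0).
    rewrite -E2; apply: sweep_le => // x y sx xy y2; rewrite !cos_sym.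
    by apply: ler_cos_pi2pi; rewrite ?mulr2n; lra.
  rewrite -E0; apply: sweep_le => // x y x0' xy yf; apply: ler_cos_0pi; lra.
Qed.

(** As an intersection of half-planes it is clearly closed and convex. It contains the contact
    points, so every half-plane is supporting and the support function can be read off. *)
Definition swept_body : set plane :=
  [set x | forall f, 0 <= f <= pi *+ 2 -> height f x <= height f (contact f)].

Lemma contact_in s : 0 <= s <= pi *+ 2 -> swept_body (contact s).
Proof. by move=> s2 f f2; exact: height_contact_le. Qed.

Lemma height_contactDpi s : 0 <= s <= pi ->
  height (s + pi) (contact (s + pi)) = 1 - height s (contact s).
Proof.
by move=> s0; rewrite heightDpi contactDpi// heightB height_circle subrr cos0; ring.
Qed.

Lemma swept_body_width x s : swept_body x -> 0 <= s <= pi ->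
  height s (contact s) - 1 <= height s x <= height s (contact s).
Proof.
move=> Kx s0; have p0 := @pi_gt0 R; rewrite Kx ?andbT ?mulr2n; last by lra.
have := Kx (s + pi); rewrite height_contactDpi// heightDpi mulr2n; lra.
Qed.

Lemma swept_body_dist x y : swept_body x -> swept_body y -> eucl_dist x y <= 1.
Proof.
move=> Kx Ky; apply: eucl_dist_leP => t; rewrite mulr2n => /andP[t0 t2].
have [tpi|tpi] := leP t pi.
  have := swept_body_width Kx (s := t); have := swept_body_width Ky (s := t); lra.
have := swept_body_width Kx (s := t - pi); have := swept_body_width Ky (s := t - pi).
by rewrite -[in height t x](subrK pi t) -[in height t y](subrK pi t) !heightDpi; lra.
Qed.

Lemma closed_swept_body : closed swept_body.
Proof.
rewrite (_ : swept_body = \bigcap_(f in [set f | 0 <= f <= pi *+ 2])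
  [set x : plane | height f x <= height f (contact f)])//.
apply: closed_bigI => f _; apply: closed_comp (@closed_le _ _) => x _.
exact: continuous_height.
Qed.

Lemma compact_swept_body : compact swept_body.
Proof. exact: bounded_eucl_compact closed_swept_body swept_body_dist. Qed.

Lemma convex_swept_body : convex_set swept_body.
Proof.
apply/convex_setP => x y a Kx Ky /andP[a0 a1] f f2.
rewrite heightD !heightZ; have := Kx f f2; have := Ky f f2; nra.
Qed.

Lemma support_swept_body s : 0 <= s <= pi *+ 2 ->
  support_fun swept_body s = height s (contact s).
Proof.
move=> s2; apply/eqP; rewrite eq_le; apply/andP; split.
  apply: ge_sup; first by exists (height s (contact s)), (contact s);
    first exact: contact_in.
  by move=> _ [x Kx <-]; exact: Kx.
by apply: height_le_support; [exact: compact_swept_body|exact: contact_in].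
Qed.

Definition body_center : plane :=
  4^-1 *: (contact 0 + contact pi + contact (pi / 2) + contact (pi / 2 + pi)).

(** The centre is the mean of the ends of two perpendicular unit diameters, whose ends differ in
    height by [|cos f|] and [|sin f|]. So it lies below the maximum by at least a quarter of
    [|cos f| + |sin f|], and this sum is at least [cos^2 f + sin^2 f = 1]. *)
Lemma height_body_center f : 0 <= f <= pi *+ 2 ->
  height f body_center + 4^-1 <= height f (contact f).
Proof.
move=> f2; have p0 := @pi_gt0 R; rewrite /body_center heightZ 3!heightD.
have H0 : height f (contact 0) <= height f (contact f).
  by apply: height_contact_le => //; rewrite [pi *+ 2]mulr2n; lra.
have H1 : height f (contact pi) <= height f (contact f).
  by apply: height_contact_le => //; rewrite [pi *+ 2]mulr2n; lra.
have H2 : height f (contact (pi / 2)) <= height f (contact f).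
  by apply: height_contact_le => //; rewrite [pi *+ 2]mulr2n; lra.
have H3 : height f (contact (pi / 2 + pi)) <= height f (contact f).
  by apply: height_contact_le => //; rewrite [pi *+ 2]mulr2n; lra.
have E1 : height f (contact pi) = height f (contact 0) - cos f.
  by rewrite -{1}[pi]add0r contactDpi ?lexx ?ltW// heightB height_circle subr0.
have E3 : height f (contact (pi / 2 + pi)) = height f (contact (pi / 2)) - sin f.
  rewrite contactDpi; last by lra.
  by rewrite heightB height_circle cosBpihalf.
have sq_le (c : R) : `|c| <= 1 -> c ^+ 2 <= `|c|.
  by move=> c1; rewrite -real_normK ?num_real// expr2 ler_piMr.
have := cos2Dsin2 f; have := sq_le _ (cos_max f); have := sq_le _ (sin_max f).
by have [] := ger0P (cos f); have [] := ger0P (sin f); lra.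
Qed.

Lemma swept_body_interior : interior swept_body !=set0.
Proof.
(* In a square of half-side 1/8 the height differs from that of the centre by at most 1/8 + 1/8 =
   1/4. *)
exists body_center; apply/nbhs_ballP; exists (8^-1 : R) => //=.
move=> y [b1 b2] f f2; have := height_body_center f2.
have bound (a b c : R) : `|b - a| < 8^-1 -> `|c| <= 1 -> (a - b) * c <= 8^-1.
  rewrite distrC => ab c1; apply: le_trans (ler_norm _) _.
  by rewrite normrM -[8^-1]mulr1 ler_pM// ltW.
have := bound _ _ _ b1 (cos_max f); have := bound _ _ _ b2 (sin_max f).
by rewrite /height; lra.
Qed.

Lemma support_funD2pi (K : set plane) t : support_fun K (t + pi *+ 2) = support_fun K t.
Proof.
by rewrite /support_fun; congr sup; apply/seteqP; split=> _ [x Kx <-]; exists x;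
  rewrite // cosD2pi sinD2pi.
Qed.

Lemma swept_body_constant_width : constant_width1 swept_body.
Proof.
split.
  split; last exact: swept_body_interior.
  by split; [exact: compact_swept_body|exact: convex_swept_body].
have p0 := @pi_gt0 R.
have E t : 0 <= t <= pi -> support_fun swept_body t + support_fun swept_body (t + pi) = 1.
  move=> t0; rewrite !support_swept_body ?mulr2n; try lra.
  by rewrite height_contactDpi// addrC subrK.
have E2 t : 0 <= t < pi *+ 2 -> support_fun swept_body t + support_fun swept_body (t +
  pi) = 1.
  rewrite mulr2n => /andP[t0 t2]; have [tpi|tpi] := leP t pi; first by apply: E;
    rewrite t0.
  have -> : t + pi = t - pi + pi *+ 2 by rewrite mulr2n; ring.
  rewrite support_funD2pi addrC -[X in _ + support_fun _ X](subrK pi t).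
  by apply: E; lra.
move=> t; have [s s2 [Es Es']] := polar_coordinates (cos t) (sin t).
rewrite cos2Dsin2 sqrtr1 !mul1r in Es Es'.
rewrite -(E2 s s2); congr (_ + _); rewrite /support_fun; congr sup.
  by rewrite Es Es'.
by rewrite !cosDpi !sinDpi Es Es'.
Qed.

End SweptBody.

(** * Connected components of the arcs *)

Section Arcs.
Context {R : realType}.
Notation plane := (R * R)%type.
Implicit Types (s t m : R).

Lemma cos_lt (a b : R) : 0 <= a -> a < b -> b < pi *+ 2 - a -> cos b < cos a.
Proof.
rewrite mulr2n => a0 ab ba; have [bpi|bpi] := leP b pi.
  by rewrite ltr_cos ?in_itv/=//; lra.
have -> : cos b = cos (pi + pi - b) by rewrite -mulr2n addrC cosD2pi cosN.
by rewrite ltr_cos ?in_itv/=; lra.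
Qed.

Lemma circle_point_inj s t : 0 <= s < pi *+ 2 -> 0 <= t < pi *+ 2 ->
  circle_point s = circle_point t -> s = t.
Proof.
wlog st : s t / s <= t.
  move=> H s2 t2 E; have [/H|/ltW/H] := leP s t; first exact.
  by move=> /(_ t2 s2 (esym E)) ->.
move=> /andP[s0 s2] /andP[t0 t2] [Ec Es].
apply/eqP; rewrite eq_le st leNgt/=; apply/negP => lt_st.
have : cos (t - s) < cos 0 by apply: cos_lt; lra.
by rewrite cosB Ec Es -!expr2 cos2Dsin2 cos0 ltxx.
Qed.

(* The line through [circle_point 0] and [circle_point m] separates the two
   arcs of the circle between these points. *)
Definition side m (x : plane) : R := height (m / 2) x - cos (m / 2).

Lemma side_gt0 m t : 0 < t < m -> m <= pi *+ 2 -> 0 < side m (circle_point t).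
Proof.
move=> /andP[t0 tm] m2; rewrite /side height_circle subr_gt0 -[X in _ < X]cos_norm.
apply: cos_lt => //; first by rewrite ltr_norml; lra.
by rewrite ltrBrDl -ltrBrDr ltr_norml; move: m2; rewrite mulr2n; lra.
Qed.

Lemma side_lt0 m t : 0 < m < t -> t < pi *+ 2 -> side m (circle_point t) < 0.
Proof.
move=> /andP[m0 mt] t2; rewrite /side height_circle subr_lt0 -cosN opprB.
by apply: cos_lt; lra.
Qed.

Variables (n : nat) (tau : nat -> R).
Hypothesis tau0 : tau 0 = 0.
Hypothesis tau_lt : forall k, (k < n.*2)%N -> tau k < tau k.+1.
Hypothesis tauDpi : forall k, (k <= n)%N -> tau (n + k) = tau k + pi.

Definition odd_intervals : seq (R * R) :=
  [seq (tau i.*2.+1, tau i.*2.+2) | i <- iota 0 n].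

Definition odd_arc i : set plane :=
  circle_point @` `[tau i.*2.+1, tau i.*2.+2[%classic.

Lemma odd_interval_bounds i t : (i < n)%N -> tau i.*2.+1 <= t < tau i.*2.+2 ->
  0 < t < pi *+ 2.
Proof.
move=> iN /andP[t1 t2]; rewrite -(tau_2n tau0 tauDpi); apply/andP; split.
  by apply: lt_le_trans t1; rewrite -tau0; apply: (tau_mono tau_lt) => //; lia.
by apply: (lt_le_trans t2); apply: (tau_le tau_lt); lia.
Qed.

Lemma arcs_odd_intervals (x : plane) :
  arcs odd_intervals x <-> exists2 i, (i < n)%N & odd_arc i x.
Proof.
split=> [[t [p /mapP[i iN ->] tp] <-]|[i iN [t tp <-]]].
  exists i; first by move: iN; rewrite mem_iota.
  by exists t => //; rewrite /= in_itv.
exists t => //; exists (tau i.*2.+1, tau i.*2.+2); last by move: tp; rewrite /= in_itv.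
by apply/mapP; exists i => //; rewrite mem_iota.
Qed.

Lemma odd_arc_circle_point i t : (i < n)%N -> 0 <= t < pi *+ 2 ->
  odd_arc i (circle_point t) <-> tau i.*2.+1 <= t < tau i.*2.+2.
Proof.
move=> iN t2; split=> [[s]|ti]; last by exists t; rewrite //= in_itv.
rewrite /= in_itv/= => si /circle_point_inj <- //.
by have /andP[/ltW -> ->] := odd_interval_bounds iN si.
Qed.

(** The middle of the even interval preceding arc [i]. As no arc contains angle 0, the line through
    the points of angles 0 and [gap_point i] separates the arcs before [i] from the others. *)
Definition gap_point i := (tau i.*2 + tau i.*2.+1) / 2.

Lemma gap_point_bounds i : (i < n)%N -> 0 < gap_point i < pi *+ 2.
Proof.
move=> iN; rewrite -(tau_2n tau0 tauDpi) /gap_point.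
have : 0 <= tau i.*2 by apply: (tau_ge0 tau0 tau_lt); lia.
have : tau i.*2 < tau i.*2.+1 by apply: tau_lt; lia.
have : tau i.*2.+1 <= tau n.*2 by apply: (tau_le tau_lt); lia.
lra.
Qed.

Lemma side_gap_lt0 i j x : (i <= j)%N -> (j < n)%N -> odd_arc j x -> side (gap_point i)
  x < 0.
Proof.
move=> ij jn [t /=]; rewrite in_itv/= => tj <-.
have /andP[g0 g2] := gap_point_bounds (leq_ltn_trans ij jn).
have /andP[t0 t2] := odd_interval_bounds jn tj.
apply: side_lt0 => //; rewrite g0/=; move/andP: tj => [tj _]; apply: lt_le_trans tj.
have : tau i.*2 < tau i.*2.+1 by apply: tau_lt; lia.
have : tau i.*2.+1 <= tau j.*2.+1 by apply: (tau_le tau_lt); lia.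
rewrite /gap_point; lra.
Qed.

Lemma side_gap_gt0 i j x : (j < i)%N -> (i < n)%N -> odd_arc j x -> 0 < side (gap_point
  i) x.
Proof.
move=> ji iN [t /=]; rewrite in_itv/= => tj <-.
have /andP[g0 g2] := gap_point_bounds iN.
have /andP[t0 t2] := odd_interval_bounds (ltn_trans ji iN) tj.
apply: side_gt0; rewrite ?ltW// t0/=; move/andP: tj => [_ tj].
apply: (@lt_le_trans _ _ (tau j.*2.+2)) => //.
have : tau i.*2 < tau i.*2.+1 by apply: tau_lt; lia.
have : tau j.*2.+2 <= tau i.*2 by apply: (tau_le tau_lt); lia.
rewrite /gap_point; lra.
Qed.

Lemma continuous_circle_point : continuous (@circle_point R).
Proof. by move=> t; exact: (cvg_pair (@continuous_cos R t) (@continuous_sin R t)). Qed.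

Lemma connected_odd_arc i : connected (odd_arc i).
Proof.
apply: connected_continuous_connected.
  by apply/connected_intervalP; exact: interval_is_interval.
by apply: continuous_subspaceT; exact: continuous_circle_point.
Qed.

(** If [i < j], then [side (gap_point j)] takes both signs on the connected set [C], but it has no
    zero on the arcs. *)
Lemma connected_sub_arc (C : set plane) i j x y : connected C ->
  C `<=` arcs odd_intervals -> C x -> C y -> (i < n)%N -> (j < n)%N ->
  odd_arc i x -> odd_arc j y -> (j <= i)%N.
Proof.
move=> conC CE Cx Cy iN jn Aix Ajy; rewrite leqNgt; apply/negP => ij.
have x0 := side_gap_gt0 ij jn Aix.
have y0 := side_gap_lt0 (leqnn j) jn Ajy.
have /connected_intervalP H : connected (side (gap_point j) @` C).
  apply: connected_continuous_connected => //; apply: continuous_subspaceT => z.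
  by apply: cvgB; [exact: continuous_height|exact: cvg_cst].
have [] := H _ _ (ex_intro2 _ _ _ Cy erefl) (ex_intro2 _ _ _ Cx erefl) 0.
  by rewrite !ltW.
move=> z Cz z0; have /arcs_odd_intervals[k kn Akz] := CE z Cz.
have [kj|jk] := ltnP k j.
  by have := side_gap_gt0 kj jn Akz; rewrite z0 ltxx.
by have := side_gap_lt0 jk kn Akz; rewrite z0 ltxx.
Qed.

Lemma component_odd_arc i x : (i < n)%N -> odd_arc i x ->
  connected_component (arcs odd_intervals) x = odd_arc i.
Proof.
move=> iN Aix; apply/seteqP; split=> [y Cy|].
  set C := connected_component _ x in Cy.
  have CE : C `<=` arcs odd_intervals by exact: connected_component_sub.
  have conC : connected C by exact: component_connected.
  have Cx : C x by apply: connected_component_refl; apply/arcs_odd_intervals; exists i.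
  have /arcs_odd_intervals[j jn Ajy] := CE y Cy.
  suff -> : i = j by [].
  apply/eqP; rewrite eqn_leq (connected_sub_arc conC CE Cy Cx jn iN Ajy Aix).
  exact: (connected_sub_arc conC CE Cx Cy iN jn Aix Ajy).
apply: connected_component_max => //; last exact: connected_odd_arc.
by move=> y Aiy; apply/arcs_odd_intervals; exists i.
Qed.

Lemma card_components_odd_arcs : (components (arcs odd_intervals) #= `I_n)%card.
Proof.
have nonempty i : (i < n)%N -> odd_arc i (circle_point (tau i.*2.+1)).
  move=> iN; exists (tau i.*2.+1) => //=; rewrite in_itv/= lexx tau_lt//; lia.
have -> : components (arcs odd_intervals) = odd_arc @` `I_n.
  apply/seteqP; split=> [_ [x /arcs_odd_intervals[i iN Aix] <-]|_ [i iN <-]].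
    by exists i => //; rewrite (component_odd_arc iN Aix).
  exists (circle_point (tau i.*2.+1)).
    by apply/arcs_odd_intervals; exists i => //; exact: nonempty.
  by rewrite (component_odd_arc iN)//; exact: nonempty.
apply: inj_card_eq => i j; rewrite !inE => iN jn Aij.
have conj := connected_odd_arc (i := i).
have AE : odd_arc i `<=` arcs odd_intervals.
  by move=> y Aiy; apply/arcs_odd_intervals; exists i.
have xi := nonempty i iN; have xj := xi; rewrite Aij in xj.
apply/eqP; rewrite eqn_leq (connected_sub_arc conj AE xi xi jn iN xj xi).
exact: (connected_sub_arc conj AE xi xi iN jn xi xj).
Qed.

End Arcs.

(** * The curvature density *)

Section PiecewiseFTC.
Context {R : realType}.
Notation mu := (@lebesgue_measure R).

Lemma Rintegral_continuous_FTC2 (f F : R -> R) (a b : R) : a < b ->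
  continuous f -> (forall t : R, is_derive t 1 F (f t)) ->
  \int[mu]_(t in `[a, b]) f t = F b - F a.
Proof.
move=> ab cf dF; rewrite /Rintegral (continuous_FTC2 (F := F) ab)//.
- exact: continuous_subspaceT.
- have cF : continuous F.
    by move=> x; apply/differentiable_continuous/derivable1_diffP; have [] := dF x.
  split.
  + by move=> x _; have [] := dF x.
  + exact: cvg_at_right_filter (cF a).
  + exact: cvg_at_left_filter (cF b).
- by move=> x _; rewrite derive1E; have [] := dF x.
Qed.

(** The pieces [Bk] agree with [B] at the break points, so their increments telescope. The integrand
    is compared with [ek] only on open intervals and may jump between them. *)
Lemma piecewise_FTC2 (e B : R -> R) (tau : nat -> R) (N : nat) :
  (forall k, (k < N)%N -> tau k < tau k.+1) ->
  mu.-integrable `[tau 0, tau N] (EFin \o e) ->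
  (forall k, (k < N)%N -> exists ek Bk : R -> R,
     [/\ continuous ek, forall t : R, is_derive t 1 Bk (ek t),
         {in `]tau k, tau k.+1[, e =1 ek},
         Bk (tau k) = B (tau k) & Bk (tau k.+1) = B (tau k.+1)]) ->
  \int[mu]_(t in `[tau 0, tau N]) e t = B (tau N) - B (tau 0).
Proof.
move=> tau_lt ie He.
have tau_le i j : (i <= j)%N -> (j <= N)%N -> tau i <= tau j.
  elim: j => [|j IH]; first by rewrite leqn0 => /eqP ->.
  rewrite leq_eqVlt => /predU1P[-> //|ij] jN.
  by apply: le_trans (IH ij (ltnW jN)) _; apply/ltW/tau_lt.
suff H k : (k <= N)%N -> \int[mu]_(t in `[tau 0, tau k]) e t = B (tau k) - B (tau 0).
  exact: H.
elim: k => [_|k IH kN]; first by rewrite set_itv1 Rintegral_set1 subrr.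
have [ek [Bk [cek dBk eE Bk0 Bk1]]] := He k kN.
have iek : mu.-integrable `[tau k, tau k.+1] (EFin \o ek).
  by apply: continuous_compact_integrable;
    [exact: segment_compact|exact: continuous_subspaceT].
have ieko : mu.-integrable `]tau k, tau k.+1[ (EFin \o ek).
  by apply: integrableS iek => //; apply: subset_itv; rewrite bnd_simp.
have ieko' : mu.-integrable `[tau k, tau k.+1[ (EFin \o ek).
  by apply: integrableS iek => //; apply: subset_itv; rewrite bnd_simp.
have sub : [set` Interval (BRight (tau k)) (BLeft (tau k.+1))] `<=` `[tau 0, tau N].
  apply: subset_itv; rewrite bnd_simp; apply: tau_le => //; exact: ltnW.
have ie1 : mu.-integrable `[tau 0, tau k.+1] (EFin \o e).
  by apply: integrableS ie => //; apply: subset_itvl; rewrite bnd_simp tau_le.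
have := @Rintegral_itvB R e (BLeft (tau 0)) (BRight (tau k.+1)) (tau k) ie1.
rewrite !bnd_simp tau_le ?(ltnW kN)// tau_le// IH ?(ltnW kN)// => /(_ isT isT).
rewrite -(Rintegral_itv_bndo_bndc (a := BRight (tau k))); last by apply: integrableS ie.
have -> : \int[mu]_(t in `]tau k, tau k.+1[) e t = \int[mu]_(t in `]tau k, tau k.+1[)
  ek t.
  by apply: eq_Rintegral => t; rewrite inE; exact: eE.
rewrite Rintegral_itv_obnd_cbnd// Rintegral_itv_bndo_bndc//.
rewrite (Rintegral_continuous_FTC2 (tau_lt _ kN) cek dBk) Bk0 Bk1; lra.
Qed.

End PiecewiseFTC.

(** * The density carried by the odd arcs, and its measurability *)

Section Density.
Context {R : realType}.
Notation plane := (R * R)%type.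
Notation mu := (@lebesgue_measure R).
Implicit Types (s t : R).

Variables (n : nat) (tau : nat -> R).
Notation S := (sweep n tau).
Hypothesis tau0 : tau 0 = 0.
Hypothesis tau_lt : forall k, (k < n.*2)%N -> tau k < tau k.+1.
Hypothesis tauDpi : forall k, (k <= n)%N -> tau (n + k) = tau k + pi.

Definition arc_density t : R := \1_(arcs (odd_intervals n tau)) (circle_point t).

(** Only the term of index [k] varies on this interval: earlier ones are complete, later ones have
    not begun. *)
Lemma sweep_on k s (G : R -> R) : (k < n.*2)%N -> tau k <= s <= tau k.+1 ->
  S G s = S G (tau k) + (odd k)%:R * (G s - G (tau k)).
Proof.
move=> kn /andP[ks sk]; apply/eqP; rewrite addrC -subr_eq -sumrB big_mkcond/=.
rewrite (bigD1 (Ordinal kn))//= big1 ?addr0; last first.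
  move=> j; rewrite -val_eqE/= neq_ltn => /orP[jk|kj]; case: ifP => // _.
    have jk1 : tau j.+1 <= tau k by apply: (tau_le tau_lt) => //; exact: ltnW.
    have jk0 : tau j <= tau k by apply: (tau_le tau_lt); exact: ltnW.
    by rewrite !(min_idPr _) ?subrr//; lra.
  have jn := ltn_ord j.
  have kj1 : tau k.+1 <= tau j.+1 by apply: (tau_le tau_lt) => //; exact: leqW.
  have kj0 : tau k.+1 <= tau j by apply: (tau_le tau_lt) => //; exact: ltnW.
  have kk := tau_lt kn.
  by rewrite !(min_idPl _) ?subrr//; lra.
have kk := tau_lt kn.
rewrite (min_idPl sk) (min_idPr ks) minxx (min_idPl _) ?(ltW kk)// subrr subr0.
by case: (odd k); rewrite ?mul1r ?mul0r.
Qed.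

Lemma arc_density_on k t : (k < n.*2)%N -> tau k < t < tau k.+1 ->
  arc_density t = (odd k)%:R.
Proof.
move=> kn /andP[kt tk].
have t2 : 0 <= t < pi *+ 2.
  rewrite -(tau_2n tau0 tauDpi); apply/andP; split.
    by apply: le_trans (ltW kt); apply: (tau_ge0 tau0 tau_lt); exact: ltnW.
  by apply: (lt_le_trans tk); apply: (tau_le tau_lt).
rewrite /arc_density indicE; congr ((nat_of_bool _)%:R); apply/idP/idP => [|ok].
  rewrite inE => /arcs_odd_intervals[i iN].
  move=> /(odd_arc_circle_point tau0 tau_lt tauDpi iN t2)/andP[it ti].
  have [ki|] := ltnP k i.*2.+1.
    have : tau k.+1 <= tau i.*2.+1 by apply: (tau_le tau_lt); lia.
    lra.
  rewrite leq_eqVlt => /predU1P[<-|ik]; first by rewrite /= odd_double.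
  have : tau i.*2.+2 <= tau k by apply: (tau_le tau_lt); lia.
  lra.
rewrite inE; apply/arcs_odd_intervals; exists k./2; first by lia.
have kE : k = k./2.*2.+1 by rewrite -[LHS]odd_double_half ok.
by exists t => //=; rewrite in_itv/= -kE (ltW kt) tk.
Qed.

(** For every real [t], not only in [[0, 2 pi[], the arc is described by inequalities on continuous
    functions of [t]; this gives measurability. *)
Lemma odd_arc_side i t : (i < n)%N ->
  odd_arc tau i (circle_point t) <->
  side (tau i.*2.+1) (circle_point t) <= 0 /\ 0 < side (tau i.*2.+2) (circle_point t).
Proof.
move=> iN; have [s s2 [Es Es']] := polar_coordinates (cos t) (sin t).
rewrite cos2Dsin2 sqrtr1 !mul1r in Es Es'.
have -> : circle_point t = circle_point s by rewrite /circle_point Es Es'.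
have a0 : 0 < tau i.*2.+1 by rewrite -tau0; apply: (tau_mono tau_lt) => //; lia.
have ab : tau i.*2.+1 < tau i.*2.+2 by apply: tau_lt; lia.
have b2 : tau i.*2.+2 <= pi *+ 2.
  by rewrite -(tau_2n tau0 tauDpi); apply: (tau_le tau_lt); lia.
rewrite (odd_arc_circle_point tau0 tau_lt tauDpi iN s2);
  move: (tau i.*2.+1) (tau i.*2.+2) a0 ab b2 => a b a0 ab b2.
have side0 m : side m (circle_point 0) = 0 :> R by rewrite /side height_circle subr0
  subrr.
have sidem m : side m (circle_point m) = 0 :> R.
  rewrite /side height_circle (_ : m / 2 - m = - (m / 2)) ?cosN ?subrr//; lra.
split=> [/andP[as_ sb]|[Ha Hb]].
  split; last by apply: side_gt0 => //; rewrite sb andbT; lra.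
  move: as_; rewrite le_eqVlt => /predU1P[<-|as_]; first by rewrite sidem.
  by apply/ltW/side_lt0; rewrite ?a0//; lra.
have s_gt0 : 0 < s.
  rewrite lt_def; case/andP: s2 => -> _; rewrite andbT; apply: contraTneq Hb => ->.
  by rewrite side0 ltxx.
apply/andP; split.
  rewrite leNgt; apply/negP => sa; move: Ha; rewrite leNgt => /negP; apply.
  by apply: side_gt0; [rewrite s_gt0|lra].
rewrite ltNge le_eqVlt; apply/negP => /predU1P[bs|bs].
  by move: Hb; rewrite bs sidem ltxx.
have : side b (circle_point s) < 0 by apply: side_lt0; [lra|case/andP: s2].
by rewrite (lt_gtF Hb).
Qed.

Lemma continuous_side_circle_point m : continuous (fun t => side m (circle_point t)).
Proof.
move=> t; apply: cvgB; last exact: cvg_cst.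
apply: (continuous_comp (g := height (m / 2))); first exact: continuous_circle_point.
exact: continuous_height.
Qed.

Lemma measurable_arc_density : measurable_fun setT arc_density.
Proof.
suff mA : measurable ((@circle_point R) @^-1` arcs (odd_intervals n tau) : set
  (measurableTypeR R)).
  by rewrite (_ : arc_density = \1_(circle_point @^-1` arcs (odd_intervals n tau))).
have -> : (@circle_point R) @^-1` arcs (odd_intervals n tau) = \bigcup_(i in `I_n)
  ([set t | side (tau i.*2.+1) (circle_point t) <= 0] `&`
   [set t | 0 < side (tau i.*2.+2) (circle_point t)]).
  apply/seteqP; split=> t.
    by move=> /arcs_odd_intervals[i iN /odd_arc_side H]; exists i => //; exact: H.
  by move=> [i iN H]; apply/arcs_odd_intervals; exists i => //; exact/odd_arc_side.
have mside m : measurable_fun setT (fun t : R => side m (circle_point t)).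
  by apply: continuous_measurable_fun; exact: continuous_side_circle_point.
apply: bigcup_measurable => i _; apply: measurableI.
  have := mside (tau i.*2.+1) measurableT _ (measurable_itv `]-oo, 0]).
  by rewrite setTI (_ : _ @^-1` _ = [set t | side (tau i.*2.+1) (circle_point t) <= 0]).
have := mside (tau i.*2.+2) measurableT _ (measurable_itv `]0, +oo[).
rewrite setTI (_ : _ @^-1` _ = [set t | 0 < side (tau i.*2.+2) (circle_point t)])//.
by apply/seteqP; split=> t; rewrite /= in_itv/= andbT.
Qed.

End Density.

(** * The curvature density of the swept body *)

Section CurvatureDensity.
Context {R : realType}.
Notation plane := (R * R)%type.
Notation mu := (@lebesgue_measure R).
Implicit Types (s t : R).

Variables (x0 : plane) (n : nat) (tau : nat -> R).
Notation S := (sweep n tau).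
Hypothesis tau0 : tau 0 = 0.
Hypothesis tau_lt : forall k, (k < n.*2)%N -> tau k < tau k.+1.
Hypothesis tauDpi : forall k, (k <= n)%N -> tau (n + k) = tau k + pi.
Hypothesis n_odd : odd n.
Hypothesis sweep_cos_pi : S cos pi = -1.
Hypothesis sweep_sin_pi : S sin pi = 0.
Notation contact := (contact x0 n tau).
Notation body := (swept_body x0 n tau).
Notation rho := (arc_density n tau).

Lemma continuous_sweep (G : R -> R) : continuous G -> continuous (S G).
Proof.
move=> cG; have cm a : continuous (fun t => G (Num.min t a)).
  move=> t; apply: (continuous_comp (f := fun t => Num.min t a)); last exact: cG.
  have /= := @min_fun_continuous _ _ R (fun t => t) (fun=> a).
  by apply; [move=> u; exact: cvg_id|move=> u; exact: cvg_cst].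
move=> t; rewrite /sweep; apply: cvg_big => [|k _]; first exact: add_continuous.
by apply: cvgB; exact: cm.
Qed.

Lemma height_contact_on k t : (k < n.*2)%N -> tau k <= t <= tau k.+1 ->
  let q := contact (tau k) - (odd k)%:R *: circle_point (tau k) in
  forall f, height f (contact t) = height f q + (odd k)%:R * cos (f - t).
Proof.
move=> kn tk q f; rewrite /q !height_contact (sweep_on tau_lt _ kn tk).
by rewrite heightB heightZ height_circle height_contact; ring.
Qed.

Lemma is_derive_height (q : plane) t :
  is_derive t (1 : R) (fun t => height t q) (height (t + pi / 2) q).
Proof.
rewrite /height cosDpihalf sinDpihalf.
by apply: is_derive_eq; rewrite /GRing.scale/=; ring.
Qed.

(** Integration by parts: on each interval [h + h'' = rho], so [h (phi + phi'') - phi rho] is the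
    derivative of [B = h phi' - h' phi], whose values at 0 and [2 pi] agree by periodicity. Here
    [h' t] is the height of the contact point in direction [t + pi / 2]. *)
Lemma curvature_identity (phi : R -> R) : circle_test_fun phi ->
  \int[mu]_(t in `[0, pi *+ 2]) (support_fun body t * (phi t + derive1n 2 phi t)) =
  \int[mu]_(t in `[0, pi *+ 2]) (phi t * rho t).
Proof.
move=> [phiP phiD].
pose phi1 : R -> R := derive1n 1 phi; pose phi2 : R -> R := derive1n 2 phi.
have d0 (t : R) : is_derive t (1 : R) phi (phi1 t).
  by apply: DeriveDef; [exact: (phiD 0)|rewrite /phi1 derive1n1 derive1E].
have d1 (t : R) : is_derive t (1 : R) phi1 (phi2 t).
  by apply: DeriveDef; [exact: (phiD 1)|rewrite /phi2 derive1nS derive1E].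
have cd k : continuous (derive1n k phi).
  by move=> t; apply: differentiable_continuous; apply/derivable1_diffP; exact: phiD.
have c0 : continuous phi := cd 0.
have c1 : continuous phi1 := cd 1.
have c2 : continuous phi2 := cd 2.
have phi1P t : phi1 (t + pi *+ 2) = phi1 t.
  have ds : is_derive t (1 : R) (fun u => u + pi *+ 2) 1.
    by apply: is_derive_eq; rewrite addr0.
  have := is_derive1_comp (f := phi) (g := fun u => u + pi *+ 2) (d0 _) ds.
  rewrite (_ : _ \o _ = phi); last by apply/funext => u /=; exact: phiP.
  by rewrite mulr1 => -[_ <-]; have [_] := d0 t.
pose h t := height t (contact t).
pose B t := h t * phi1 t - height (t + pi / 2) (contact t) * phi t.
have cS (G : R -> R) : continuous G -> continuous (S G) by exact: continuous_sweep.
have ch : continuous h.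
  move=> t; rewrite /h /height; apply: cvgD; apply: cvgM.
  - by apply: cvgD; [exact: cvg_cst|apply: cS; exact: continuous_cos].
  - exact: continuous_cos.
  - by apply: cvgD; [exact: cvg_cst|apply: cS; exact: continuous_sin].
  - exact: continuous_sin.
pose F t := h t * (phi t + phi2 t); pose g t := phi t * rho t.
have cF : continuous F.
  by move=> t; apply: cvgM; [exact: ch|apply: cvgD; [exact: c0|exact: c2]].
have iF : mu.-integrable `[0, pi *+ 2] (EFin \o F).
  by apply: continuous_compact_integrable;
    [exact: segment_compact|exact: continuous_subspaceT].
have ig : mu.-integrable `[0, pi *+ 2] (EFin \o g).
  have iphi : mu.-integrable `[0, pi *+ 2] (EFin \o phi).
    by apply: continuous_compact_integrable;
      [exact: segment_compact|exact: continuous_subspaceT].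
  apply: le_integrable iphi => //.
    apply/measurable_EFinP; apply: measurable_funTS; apply: measurable_funM.
      exact: continuous_measurable_fun.
    exact: measurable_arc_density.
  move=> t _; rewrite /= lee_fin normrM ler_piMr//.
  by rewrite /arc_density indicE; case: (_ \in _); rewrite ?normr1 ?normr0 ?ler01.
transitivity (\int[mu]_(t in `[0, pi *+ 2]) F t).
  apply: eq_Rintegral => t; rewrite inE/= in_itv/= => t2.
  by rewrite (support_swept_body _ tau0 tau_lt tauDpi n_odd sweep_cos_pi sweep_sin_pi t2).
apply/eqP; rewrite -subr_eq0 -RintegralB//.
rewrite -(tau_2n tau0 tauDpi) -[X in `[X, _]]tau0.
rewrite (@piecewise_FTC2 _ _ B)//.
- rewrite (tau_2n tau0 tauDpi) tau0 /B /h contact2pi// contact0//.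
  by rewrite -[pi *+ 2]add0r phi1P phiP [0 + _ + _ / _]addrAC !heightD2pi subrr.
- rewrite tau0 (tau_2n tau0 tauDpi).
  have mI : measurable (`[0, pi *+ 2]%classic : set (measurableTypeR R)).
    exact: measurable_itv.
  exact: (integrableB mI iF ig).
move=> k kn; pose w : R := (odd k)%:R.
(* On this interval the boundary is an arc of the unit circle around [q] if [w = 1], and the vertex
   [q] if [w = 0]; thus [h t = height t q + w]. *)
pose q := contact (tau k) - w *: circle_point (tau k).
have hk t f : tau k <= t <= tau k.+1 -> height f (contact t) = height f q + w * cos (f
  - t).
  by move=> tk; exact: (height_contact_on kn tk).
have ckq : continuous (fun t => height t q).
  by move=> t; apply/differentiable_continuous/derivable1_diffP;
    have [] := is_derive_height q t.
exists (fun t => (height t q + w) * phi2 t + height t q * phi t).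
exists (fun t => (height t q + w) * phi1 t - height (t + pi / 2) q * phi t).
have tk_lt := tau_lt kn.
have Bk t : tau k <= t <= tau k.+1 ->
    (height t q + w) * phi1 t - height (t + pi / 2) q * phi t = B t.
  move=> tk; rewrite /B /h !hk// subrr cos0 mulr1.
  by rewrite [t + _ - t]addrAC subrr add0r cos_pihalf mulr0 addr0.
split.
- move=> t; apply: cvgD; apply: cvgM; [|exact: c2|exact: ckq|exact: c0].
  by apply: cvgD; [exact: ckq|exact: cvg_cst].
- move=> t; have dh := is_derive_height q t.
  have dh' : is_derive t (1 : R) (fun t => height (t + pi / 2) q) (- height t q).
    have ds : is_derive t (1 : R) (fun u => u + pi / 2) 1.
      by apply: is_derive_eq; rewrite addr0.
    have := is_derive1_comp (f := fun u => height u q) (g := fun u => u + pi / 2)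
      (is_derive_height q _) ds.
    by rewrite mulr1 -addrA -splitr heightDpi.
  by apply: is_derive_eq; rewrite /GRing.scale/=; ring.
- move=> t; rewrite in_itv/= => tk; have tk' : tau k <= t <= tau k.+1 by lra.
  rewrite /F /g /h hk// subrr cos0 (arc_density_on tau0 tau_lt tauDpi kn tk).
  by rewrite -/w; ring.
- by apply: Bk; rewrite lexx ltW.
- by apply: Bk; rewrite lexx ltW.
Qed.

Lemma has_curvature_density_swept_body : has_curvature_density (support_fun body) rho.
Proof.
split.
- by move=> t; rewrite /arc_density /circle_point cosD2pi sinD2pi.
- exact: measurable_arc_density.
- apply: measurable_bounded_integrable => //.
  + have fin_itv : (mu `[0%R, (pi *+ 2)%R]%classic < +oo)%E.
      by rewrite lebesgue_measure_itv/=; case: ifP => _; rewrite ?ltry// -EFinB ltry.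
    exact: fin_itv.
  + by apply: measurable_funTS; exact: measurable_arc_density.
  + exists 1; split; [exact: num_real|] => M M1 t _.
    by rewrite /= /arc_density indicE (le_trans _ (ltW M1))//; case: (_ \in _);
      rewrite ?normr1 ?normr0.
- exact: curvature_identity.
Qed.

Lemma reuleaux_swept_body : reuleaux n body.
Proof.
split; first exact: swept_body_constant_width.
exists rho, (odd_intervals n tau); split.
- exact: has_curvature_density_swept_body.
- exact: aeW.
- exact: card_components_odd_arcs.
Qed.

End CurvatureDensity.

(** * Approximation of sets of diameter at most 1 *)

Section Steps.
Context {R : realType}.
Notation plane := (R * R)%type.
Implicit Types (x y z : plane) (s t L : R).

Lemma sin_le_id s : 0 <= s -> sin s <= s.
Proof.
move=> s0; have [c _] := @MVT_segment R sin cos 0 s s0 (fun r _ => is_derive_sin r)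
  (continuous_subspaceT (@continuous_sin R)).
rewrite sin0 !subr0 => ->; rewrite ler_piMl//; exact: cos_le1.
Qed.

(** From the mean value theorem and [sin c <= c]. This quadratic bound, for [L] of order [1 / M], is
    the source of the rate [M^-2]. *)
Lemma oneBcos_le_sqr L : 0 <= L -> 1 - cos L <= L ^+ 2.
Proof.
move=> L0; have [c] := @MVT_segment R cos (fun r => - sin r) 0 L L0
  (fun r _ => is_derive_cos r) (continuous_subspaceT (@continuous_cos R)).
rewrite in_itv/= cos0 subr0 => /andP[c0 cL] H.
have -> : 1 - cos L = sin c * L by lra.
by rewrite expr2 ler_wpM2r//; apply: le_trans cL; exact: sin_le_id.
Qed.

Lemma eucl_dist_lt1 x y : eucl_dist x y < 1 -> (x.1 - y.1) ^+ 2 + (x.2 - y.2) ^+ 2 < 1.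
Proof.
move=> xy; rewrite -eucl_dist_sqr -[X in _ < X](expr1n _ 2).
by rewrite ltr_pXn2r ?nnegrE ?eucl_dist_ge0.
Qed.

(* With y - x = l (- sin c, cos c), the two hypotheses say that
   sin (c - t) and sin (t + L - c) exceed l / 2 = sin m; take a = c - m and
   b = c + m. *)
Lemma arc_endpoints x y t L : 0 < L <= pi / 2 ->
  eucl_dist y (x - circle_point t) < 1 ->
  eucl_dist x (y - circle_point (t + L)) < 1 ->
  exists ab : R * R, [/\ t < ab.1, ab.1 < ab.2, ab.2 < t + L &
    y - x = circle_point ab.2 - circle_point ab.1].
Proof.
move=> /andP[L0 Lpi] /eucl_dist_lt1 H1 /eucl_dist_lt1 H2.
have p0 := @pi_gt0 R.
pose v1 := y.1 - x.1; pose v2 := y.2 - x.2.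
(* The angle [s] is chosen so that [y - x = l (- sin (t + s), cos (t + s))]; thus [t + s] will be
   the midpoint of the arc. *)
have [s /andP[s0 s2]] := polar_coordinates (v2 * cos t - v1 * sin t) (- (v1 * cos t +
  v2 * sin t)).
set l := Num.sqrt _ => -[E1 E2].
have l0 : 0 <= l := sqrtr_ge0 _.
have cs := cos2Dsin2 t.
have V1 : v1 = - (l * sin (t + s)).
  transitivity ((v1 * cos t + v2 * sin t) * cos t - (v2 * cos t - v1 * sin t) * sin t).
    by rewrite -[LHS]mulr1 -cs; ring.
  by rewrite E1 -[v1 * cos t + _]opprK E2 sinD; ring.
have V2 : v2 = l * cos (t + s).
  transitivity ((v1 * cos t + v2 * sin t) * sin t + (v2 * cos t - v1 * sin t) * cos t).
    by rewrite -[LHS]mulr1 -cs; ring.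
  by rewrite E1 -[v1 * cos t + _]opprK E2 cosD; ring.
have ll : l ^+ 2 = v1 ^+ 2 + v2 ^+ 2.
  by rewrite V1 V2 -[LHS]mulr1 -(cos2Dsin2 (t + s)); ring.
(* The factor [l] is kept for now, since this strict inequality is what shows that [l] is not 0. *)
have F1 : l * (l - 2 * sin s) < 0.
  have -> : l * (l - 2 * sin s) = l ^+ 2 - 2 * (l * sin s) by ring.
  by move: H1; rewrite /= ll -E2 /v1 /v2; lra.
have F2 : l * (l - 2 * sin (L - s)) < 0.
  have -> : l * (l - 2 * sin (L - s)) = l ^+ 2 - 2 * (v1 * cos (t + L) + v2 * sin (t +
    L)).
    have -> : L - s = (t + L) - (t + s) by ring.
    by rewrite V1 V2 sinB; ring.
  by move: H2 (cos2Dsin2 (t + L)); rewrite /= ll /v1 /v2; lra.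
have l_gt0 : 0 < l.
  by rewrite lt_def l0 andbT; apply: contraTneq F1 => ->; rewrite mul0r ltxx.
have {}F1 : l / 2 < sin s by move: F1; rewrite pmulr_rlt0//; lra.
have {}F2 : l / 2 < sin (L - s) by move: F2; rewrite pmulr_rlt0//; lra.
have l1 : l / 2 < 1 := lt_le_trans F1 (sin_le1 s).
have l1' : -1 <= l / 2 <= 1 by lra.
have sin_npi (r : R) : - pi <= r <= 0 -> sin r <= 0.
  by move=> r0; rewrite -[r]opprK sinN oppr_le0; apply: sin_ge0_pi; lra.
have spi : s < pi.
  rewrite ltNge; apply/negP => pis.
  have : sin (s - pi - pi) <= 0 by apply: sin_npi; move: s2; rewrite mulr2n; lra.
  have -> : sin (s - pi - pi) = sin s.
    by rewrite -[in RHS](subrK pi s) -[s - pi in RHS](subrK pi) !sinDpi opprK.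
  lra.
have sL : s < L.
  rewrite ltNge; apply/negP => Ls.
  have : sin (L - s) <= 0 by apply: sin_npi; lra.
  lra.
pose m := asin (l / 2).
have sm : sin m = l / 2 by rewrite asinK ?in_itv.
have mpi : m < pi / 2 by apply: asin_ltpi2; lra.
have mNpi : - (pi / 2) < m by apply: asin_gtNpi2; lra.
have m_gt0 : 0 < m.
  rewrite ltNge; apply/negP => m0.
  have : sin m <= 0 by apply: sin_npi; lra.
  lra.
have lt_of_sin (r : R) : 0 <= r -> r <= pi / 2 -> l / 2 < sin r -> m < r.
  by move=> r0 rpi; rewrite -sm ltr_sin ?in_itv/=; lra.
have ms : m < s.
  have [s2'|] := leP s (pi / 2); first exact: lt_of_sin.
  lra.
have mLs : m < L - s by apply: lt_of_sin => //; lra.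
exists (t + s - m, t + s + m); split=> /=; [lra|lra|lra|].
have -> : y - x = (v1, v2) by apply: injective_projections.
have {}sm : l = 2 * sin m by lra.
rewrite V1 V2; apply: injective_projections => /=.
  by rewrite cosD cosB sm; ring.
by rewrite sinB (sinD (t + s) m) sm; ring.
Qed.

(** As a function of the angle, a height is a sinusoid, determined by its values at [t] and
    [t + L]. *)
Lemma height_interpolation t L s z :
  sin L * height (t + s) z = sin (L - s) * height t z + sin s * height (t + L) z.
Proof.
by rewrite /height sinB !cosD !sinD; ring.
Qed.

(** The height of [z] is interpolated between [t], where [x] dominates, and [t + L], where [y] does.
    Replacing [y] by [x] costs at most [A] times the weight [sin s / sin L], which is at most 1. *)
Lemma height_interpolation_le t L s A z x y : 0 <= s <= L -> 0 < L <= pi / 2 ->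
  height t z <= height t x -> height (t + L) z <= height (t + L) y ->
  height (t + L) (y - x) <= A -> 0 <= A ->
  height (t + s) z <= height (t + s) x + A.
Proof.
move=> /andP[s0 sL] /andP[L0 Lpi] tz tLz yxA A0; have p0 := @pi_gt0 R.
have sinL : 0 < sin L by apply: sin_gt0_pi; lra.
have sins : 0 <= sin s by apply: sin_ge0_pi; lra.
have sinLs : 0 <= sin (L - s) by apply: sin_ge0_pi; lra.
have sinsL : sin s <= sin L.
  move: sL; rewrite le_eqVlt => /predU1P[->//|sL].
  by apply/ltW; rewrite ltr_sin ?in_itv/=; lra.
rewrite -(ler_pM2l sinL) [X in _ <= X]mulrDr (height_interpolation t L s z)
  (height_interpolation t L s x).
move: yxA; rewrite heightB => yxA.
have := ler_wpM2l sinLs tz; have := ler_wpM2l sins tLz.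
have := ler_wpM2l sins yxA; have := ler_wpM2r A0 sinsL.
rewrite mulrBr; lra.
Qed.

End Steps.

(** * A swept body passing through prescribed points *)

Section Toggles.
Context {R : realType}.
Notation plane := (R * R)%type.

Variables (N : nat) (theta a b : nat -> R) (X : nat -> plane).
Hypothesis theta0 : theta 0 = 0.
Hypothesis thetaN : theta N = pi.
Hypothesis theta_a : forall j, (j < N)%N -> theta j < a j.
Hypothesis a_b : forall j, (j < N)%N -> a j < b j.
Hypothesis b_theta : forall j, (j < N)%N -> b j < theta j.+1.
Hypothesis X_step : forall j, (j < N)%N ->
  X j.+1 - X j = circle_point (b j) - circle_point (a j).
Hypothesis X_closes : X N - X 0 = - circle_point 0.

(* The boundary points 0 < a 0 < b 0 < a 1 < ... < b N.-1 < pi. *)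
Definition half_toggle k : R :=
  if odd k then (if (k./2 < N)%N then a k./2 else pi)
  else (if k is 0 then 0 else b k./2.-1).

(** A half turn consists of [N.*2.+1] intervals, an odd number as required; the second half turn is
    its shift by [pi]. *)
Definition toggle k : R :=
  if (k <= N.*2.+1)%N then half_toggle k else half_toggle (k - N.*2.+1) + pi.

Lemma half_toggle_odd j : (j < N)%N -> half_toggle j.*2.+1 = a j.
Proof. by move=> jN; rewrite /half_toggle/= odd_double/= uphalf_double jN. Qed.

Lemma half_toggle_even j : half_toggle j.+1.*2 = b j.
Proof. by rewrite /half_toggle odd_double/= half_double. Qed.

Lemma half_toggle_last : half_toggle N.*2.+1 = pi.
Proof. by rewrite /half_toggle/= odd_double/= uphalf_double ltnn. Qed.

Lemma half_toggle_even_le j : (j <= N)%N -> half_toggle j.*2 <= theta j.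
Proof.
case: j => [_|j jN]; first by rewrite theta0.
by rewrite half_toggle_even; apply/ltW/b_theta.
Qed.

Lemma half_toggle_gt_theta j : (j < N)%N -> theta j < half_toggle j.*2.+1.
Proof. by move=> jN; rewrite half_toggle_odd// theta_a. Qed.

Lemma half_toggle_lt k : (k < N.*2.+1)%N -> half_toggle k < half_toggle k.+1.
Proof.
move=> kN; have [ok|ek] := boolP (odd k).
  have kE : k = k./2.*2.+1 by rewrite -[LHS]odd_double_half ok.
  have k2N : (k./2 < N)%N by lia.
  by rewrite kE half_toggle_odd// -doubleS half_toggle_even a_b.
have kE : k = k./2.*2 by rewrite -[LHS]odd_double_half (negbTE ek).
have [k2N|] := ltnP k./2 N.
  rewrite kE; apply: le_lt_trans (half_toggle_gt_theta k2N).
  by apply: half_toggle_even_le; exact: ltnW.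
move=> Nk; have k2N : k./2 = N by lia.
rewrite kE k2N half_toggle_last; case: (N) k2N thetaN b_theta => [_ _ _|j _ tj bt].
  exact: pi_gt0.
by rewrite half_toggle_even -tj; apply: bt.
Qed.

Lemma toggle0 : toggle 0 = 0.
Proof. by []. Qed.

Lemma toggleDpi k : (k <= N.*2.+1)%N -> toggle (N.*2.+1 + k) = toggle k + pi.
Proof.
move=> kN; rewrite /toggle kN; case: k kN => [|k] kN.
  by rewrite addn0 leqnn half_toggle_last /half_toggle/= add0r.
by rewrite ifF ?addKn//; lia.
Qed.

Lemma toggle_lt k : (k < (N.*2.+1).*2)%N -> toggle k < toggle k.+1.
Proof.
move=> kN; have [kN1|kN1] := ltnP k N.*2.+1.
  by rewrite /toggle kN1 ltnW//; exact: half_toggle_lt.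
have -> : k = (N.*2.+1 + (k - N.*2.+1))%N by lia.
rewrite -addnS !toggleDpi ?ltrD2r; [|lia|lia].
by rewrite /toggle !ifT; [apply: half_toggle_lt|..]; lia.
Qed.

Notation S := (sweep N.*2.+1 toggle).

Lemma sweep_toggle G j : (j <= N)%N ->
  S G (toggle j.*2) = \sum_(i < j) (G (b i) - G (a i)).
Proof.
elim: j => [_|j IH jN]; first by rewrite big_ord0 toggle0 (sweep0 toggle0 toggle_lt).
rewrite big_ord_recr/= -IH 1?ltnW// doubleS.
have kn1 : (j.*2.+1 < (N.*2.+1).*2)%N by lia.
have kn0 : (j.*2 < (N.*2.+1).*2)%N by lia.
rewrite (sweep_on toggle_lt G kn1); last by rewrite lexx ltW// toggle_lt.
rewrite (sweep_on toggle_lt G kn0); last by rewrite lexx ltW// toggle_lt.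
rewrite /= odd_double mul0r addr0 mul1r; congr (_ + (G _ - G _)).
  by rewrite /toggle ifT ?half_toggle_even//; lia.
by rewrite /toggle ifT ?half_toggle_odd//; lia.
Qed.

(** The angle [theta j] lies in an even interval, so exactly the first [j] arcs have been swept,
    each completely. *)
Lemma sweep_theta G j : (j <= N)%N ->
  S G (theta j) = \sum_(i < j) (G (b i) - G (a i)).
Proof.
move=> jN; have kn : (j.*2 < (N.*2.+1).*2)%N by lia.
rewrite (sweep_on toggle_lt G kn).
  by rewrite odd_double mul0r addr0 sweep_toggle.
rewrite /toggle !ifT; [|lia|lia]; rewrite half_toggle_even_le//=.
move: jN; rewrite leq_eqVlt => /predU1P[->|jN]; last exact/ltW/half_toggle_gt_theta.
by rewrite half_toggle_last thetaN.
Qed.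

Lemma contact_theta j : (j <= N)%N -> contact (X 0) N.*2.+1 toggle (theta j) = X j.
Proof.
move=> jN; rewrite /contact !sweep_theta//.
elim: j jN => [_|j IH jN].
  by rewrite !big_ord0 -[(0, 0)]/(0 : plane) addr0.
have E := X_step jN; have E' := IH (ltnW jN); rewrite !big_ord_recr/=.
by apply: injective_projections => /=;
  [have := congr1 fst E; have := congr1 fst E'|have := congr1 snd E;
    have := congr1 snd E'];
  rewrite /=; lra.
Qed.

Lemma sweep_toggle_pi : S cos pi = -1 /\ S sin pi = 0.
Proof.
have := contact_theta (leqnn N); rewrite /contact thetaN => E.
have := X_closes; rewrite -E /circle_point cos0 sin0 => {}E.
by split; [have := congr1 fst E|have := congr1 snd E]; rewrite /=; lra.
Qed.

Lemma reuleaux_toggle : reuleaux N.*2.+1 (swept_body (X 0) N.*2.+1 toggle).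
Proof.
have [c s] := sweep_toggle_pi.
apply: (reuleaux_swept_body _ toggle0 toggle_lt toggleDpi _ c s).
by rewrite /= odd_double.
Qed.

End Toggles.

(** * The perturbed chain of diameters and the approximating body *)

Section Approximation.
Context {R : realType}.
Notation plane := (R * R)%type.
Implicit Types (x y z : plane) (s : seq plane) (d : R).
Notation u := (@circle_point R).

(* The diameter [z0 - u t / 2, z0 + u t / 2] mixed with weight d makes all
   inequalities between different directions strict. *)
Definition shrink d z0 t x : plane := (1 - d) *: x + d *: (z0 + 2^-1 *: u t).

Lemma height_shrink d z0 t x f :
  height f (shrink d z0 t x) = (1 - d) * height f x + d * (height f z0 + 2^-1 * cos (f
    - t)).
Proof. by rewrite heightD !heightZ heightD heightZ height_circle. Qed.

(** In direction [f] the difference is at most [1 - d] plus [d] times the mean of [cos (f - t)] and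
    [cos (f - t')]. This mean is 1 only if [t] and [t'] both point along [f], which
    [cos (t - t') < 1] excludes. *)
Lemma shrink_dist_lt1 d z0 (t t' : R) x y : 0 < d <= 1 -> cos (t - t') < 1 ->
  eucl_dist x (y - u t') <= 1 ->
  eucl_dist (shrink d z0 t x) (shrink d z0 t' y - u t') < 1.
Proof.
move=> /andP[d0 d1] tt' xy.
have [f _ ->] := eucl_dist_height (shrink d z0 t x) (shrink d z0 t' y - u t').
have := height_le_dist f x (y - u t').
rewrite !heightB !height_shrink !height_circle => H.
have {}H : (1 - d) * (height f x - (height f y - cos (f - t'))) <= 1 - d.
  by rewrite -[leRHS]mulr1 ler_wpM2l ?subr_ge0//; exact: le_trans H xy.
have cc : cos (f - t) + cos (f - t') < 2.
  rewrite ltNge; apply/negP => c2.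
  have c1 : cos (f - t) = 1 by have := cos_le1 (f - t); have := cos_le1 (f - t'); lra.
  have c1' : cos (f - t') = 1 by have := cos_le1 (f - t); have := cos_le1 (f - t'); lra.
  have s1 : sin (f - t) = 0 by apply: cos1sin0; rewrite c1 normr1.
  move: tt'; have -> : t - t' = (f - t') - (f - t) by ring.
  by rewrite cosB c1 c1' s1; lra.
have : d * (cos (f - t) + cos (f - t')) < d * 2 by rewrite ltr_pM2l.
lra.
Qed.

Lemma shrunk_chain s z0 (N : nat) d : spread1 s -> z0 \in s -> (1 < N)%N -> 0 < d <= 1 ->
  let theta j : R := j%:R * (pi / N%:R) in
  exists X : nat -> plane,
  [/\ forall j, (j < N)%N ->
        eucl_dist (X j.+1) (X j - u (theta j)) < 1 /\
        eucl_dist (X j) (X j.+1 - u (theta j.+1)) < 1,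
      X N - X 0 = - u 0 &
      forall j z, (j <= N)%N -> z \in s ->
        let z' := (1 - d) *: z + d *: z0 in
        height (theta j) (X j) - 1 <= height (theta j) z' <= height (theta j) (X j)].
Proof.
move=> s1 z0s N1 /andP[d0 d1] theta; have p0 := @pi_gt0 R.
have N0 : 0 < N%:R :> R by rewrite ltr0n ltnW.
have thetaN : theta N = pi by rewrite /theta; field; rewrite gt_eqF.
have theta0 : theta 0%N = 0 by rewrite /theta mul0r.
have [s' [ss' s'1 Hs']] := add_diameters theta N s1.
have [y0 Hy] : exists y : nat -> plane, forall j, (j < N)%N ->
    y j \in s' /\ y j + u (theta j) \in s'.
  have [|y Hy] := @choice nat plane
    (fun j y => (j < N)%N -> y \in s' /\ y + u (theta j) \in s').
    move=> j; have [jN|] := ltnP j N; last by exists 0.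
    by have [y y1 y2] := Hs' j jN; exists y.
  by exists y.
(* The direction at index [N] is opposite to that at index 0, so the other end of the first diameter
   is taken, and the chain closes with [Y N - Y 0 = - u 0]. *)
pose Y j := if (j < N)%N then y0 j + u (theta j) else y0 0%N.
have uN : u pi = - u 0.
  by rewrite /circle_point cospi sinpi cos0 sin0; apply: injective_projections;
    rewrite /= ?oppr0.
have HY j : (j <= N)%N -> Y j \in s' /\ Y j - u (theta j) \in s'.
  rewrite leq_eqVlt /Y => /predU1P[->|jN].
    rewrite ltnn thetaN uN opprK; have := Hy 0%N (ltnW N1).
    by rewrite theta0.
  by rewrite jN addrK; have [] := Hy j jN.
have YN : Y N - Y 0%N = - u 0 by rewrite /Y ltnn (ltnW N1) theta0 opprD addrA subrr add0r.
pose X j := shrink d z0 (theta j) (Y j).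
have cosL : cos (pi / N%:R) < 1 :> R.
  rewrite -[X in _ < X]cos0; apply: cos_lt => //; first by rewrite divr_gt0.
  rewrite subr0 ltr_pdivrMr// mulr2n.
  have : 1 <= N%:R :> R by rewrite ler1n ltnW.
  nra.
have thetaB j : theta j.+1 - theta j = pi / N%:R by rewrite /theta -natr1; ring.
exists X; split.
- move=> j jN; have [Y0 Y0u] := HY j (ltnW jN); have [Y1 Y1u] := HY j.+1 jN.
  split; apply: shrink_dist_lt1; rewrite ?d0 ?d1//; try exact: s'1.
    by rewrite thetaB.
  by rewrite -cosN opprB thetaB.
- rewrite /X /shrink thetaN theta0 uN; move: YN.
  rewrite /circle_point cos0 sin0 => E.
  have := congr1 fst E; have := congr1 snd E => /= E1 E2.
  by apply: injective_projections; rewrite /= /GRing.scale/=; nra.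
- move=> j z jN zs; have [Yj Yju] := HY j jN.
  rewrite /X height_shrink subrr cos0 heightD !heightZ.
  have zY := s'1 _ _ (ss' _ zs) Yju; have Yz := s'1 _ _ Yj (ss' _ zs).
  have := height_le_dist (theta j) z (Y j - u (theta j)).
  have := height_le_dist (theta j) (Y j) z.
  rewrite heightB height_circle subrr cos0 => H1 H2.
  have {}H1 : (1 - d) * (height (theta j) (Y j) - height (theta j) z) <= 1 - d.
    by rewrite -[leRHS]mulr1 ler_wpM2l ?subr_ge0//; exact: le_trans H1 Yz.
  have {}H2 : (1 - d) * (height (theta j) z - (height (theta j) (Y j) - 1)) <= 1 - d.
    by rewrite -[leRHS]mulr1 ler_wpM2l ?subr_ge0//; exact: le_trans H2 zY.
  lra.
Qed.

Lemma reuleaux_approximation (M : nat) (K : set plane) :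
  (1 < M)%N -> unit_diameter_sets K ->
  approximable (66 * M%:R ^- 2) (reuleaux (2 * M + 1)) K.
Proof.
move=> M1 [[k0 Kk0] cK /diam_leP dK]; have p0 := @pi_gt0 R.
have p4 : pi < 4 :> R by have := @pihalf_lt2 R; lra.
have M0 : 0 < M%:R :> R by rewrite ltr0n ltnW.
have M2 : 2 <= M%:R :> R by rewrite ler_nat.
(* Both the mesh of the net and the weight of the perturbation, of the order of the allowed
   error. *)
pose d : R := M%:R ^- 2.
have d0 : 0 < d by rewrite invr_gt0 exprn_gt0.
have d1 : d <= 1 by rewrite invf_le1 ?exprn_gt0// exprn_ege1//; lra.
have [s [sK netK]] := finite_net cK d0.
have s1 : spread1 s by move=> x y /sK Kx /sK Ky; exact: dK.
have [z0 z0s _] := netK _ Kk0.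
have [|X [Xstep Xclose Xheight]] := shrunk_chain s1 z0s M1 (d := d).
  by rewrite d0 d1.
set theta := (fun j : nat => j%:R * (pi / M%:R) : R) in Xstep Xheight.
pose L : R := pi / M%:R.
have L0 : 0 < L by rewrite divr_gt0.
have L2 : L <= pi / 2 by rewrite ler_pM2l// lef_pV2 ?posrE.
have L02 : 0 < L <= pi / 2 by rewrite L0.
have thetaS j : theta j.+1 = theta j + L by rewrite /theta -natr1 /L; ring.
have thetaM : theta M = pi by rewrite /theta; field; rewrite gt_eqF.
have theta0 : theta 0%N = 0 by rewrite /theta mul0r.
have [ab Hab] : exists ab : nat -> R * R, forall j, (j < M)%N ->
    [/\ theta j < (ab j).1, (ab j).1 < (ab j).2, (ab j).2 < theta j.+1 &
      X j.+1 - X j = u (ab j).2 - u (ab j).1].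
  have [|ab Hab] := @choice nat (R * R)%type (fun j p => (j < M)%N ->
      [/\ theta j < p.1, p.1 < p.2, p.2 < theta j.+1 & X j.+1 - X j = u p.2 - u p.1]).
    move=> j; have [jM|] := ltnP j M; last by exists 0.
    have [X1 X2] := Xstep j jM.
    have [|p Hp] := arc_endpoints L02 X1 _; first by rewrite -thetaS.
    by exists p; rewrite thetaS.
  by exists ab.
pose a j := (ab j).1; pose b j := (ab j).2.
have Ha j : (j < M)%N -> theta j < a j by move=> /Hab[].
have Hb j : (j < M)%N -> a j < b j by move=> /Hab[].
have Hc j : (j < M)%N -> b j < theta j.+1 by move=> /Hab[].
have Hd j : (j < M)%N -> X j.+1 - X j = u (b j) - u (a j) by move=> /Hab[].
pose tau := toggle M a b.
have t0 : tau 0%N = 0 by exact: toggle0.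
have tlt := toggle_lt theta0 thetaM Ha Hb Hc.
have tpi := toggleDpi (N := M) a b.
have [cpi spi] := sweep_toggle_pi theta0 thetaM Ha Hb Hc Hd Xclose.
have nodd : odd M.*2.+1 by rewrite /= odd_double.
set K' := swept_body (X 0%N) M.*2.+1 tau.
exists K'.
  have -> : (2 * M + 1)%N = M.*2.+1 by lia.
  exact: (reuleaux_toggle theta0 thetaM Ha Hb Hc Hd Xclose).
pose con := contact (X 0%N) M.*2.+1 tau.
have con_theta j : (j <= M)%N -> con (theta j) = X j.
  exact: (contact_theta theta0 thetaM Ha Hb Hc Hd).
have con_le r f : 0 <= r <= pi *+ 2 -> 0 <= f <= pi *+ 2 ->
    height f (con r) <= height f (con f).
  exact: (height_contact_le _ t0 tlt tpi nodd cpi spi).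
have conDpi r : 0 <= r <= pi -> con (r + pi) = con r - u r.
  exact: (contactDpi _ t0 tlt tpi nodd cpi spi).
have theta_bounds j : (j < M)%N -> 0 <= theta j /\ theta j + L <= pi.
  move=> jM; rewrite -thetaS -thetaM /theta; split; first by rewrite mulr_ge0// ltW.
  by rewrite ler_pM2r// ler_nat.
have cosL := oneBcos_le_sqr (ltW L0).
have A0 : 0 <= L ^+ 2 by rewrite sqr_ge0.
have locate f : 0 <= f <= pi -> exists j r, [/\ (j < M)%N, 0 <= r <= L & f = theta j + r].
  move=> /andP[f0]; rewrite -thetaM => fM.
  have : forall k, (k <= M)%N -> f <= theta k -> (0 < k)%N ->
      exists j r, [/\ (j < M)%N, 0 <= r <= L & f = theta j + r].
    elim=> // k IH kM fk _; have [fk'|kf] := leP f (theta k).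
      case: k kM fk fk' IH => [|k] kM fk fk' IH; last exact: IH (ltnW kM) fk' isT.
      by exists 0%N, 0; rewrite lexx (ltW L0); split => //; move: fk'; rewrite theta0;
        lra.
    by exists k, (f - theta k); split => //; [rewrite thetaS in fk; lra|ring].
  by move=> /(_ M (leqnn M) fM); apply; exact: ltnW.
(* In the directions of the diameters the perturbed net stays within the supporting lines at the
   [X j]. Interpolation between adjacent directions loses at most [1 - cos L], since [X j.+1] is
   within distance 1 of [X j - u (theta j)]. *)
have near z f : z \in s -> 0 <= f <= pi *+ 2 ->
    height f ((1 - d) *: z + d *: z0) <= height f (con f) + L ^+ 2.
  move=> zs; set z' := _ + _ => /andP[f0 f2].
  have [fpi|pif] := leP f pi.
    have [|j [r [jM /andP[r0 rL] fE]]] := locate f; first by rewrite f0.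
    have [th0 thpi] := theta_bounds j jM; have [X1 _] := Xstep j jM.
    have /andP[_ H0] := Xheight j z (ltnW jM) zs.
    have /andP[_ H1] := Xheight j.+1 z jM zs.
    rewrite -/z' -/(theta j) in H0; rewrite -/z' -/(theta j.+1) thetaS in H1.
    rewrite fE; apply: (@le_trans _ _ (height (theta j + r) (X j) + L ^+ 2)).
      apply: (height_interpolation_le _ L02 H0 H1) => //; first by rewrite r0.
      have := height_le_dist (theta j + L) (X j.+1) (X j - u (theta j)).
      rewrite !heightB height_circle [theta j + L - _]addrAC subrr add0r.
      by move: X1; rewrite -/(theta j) => X1; lra.
    rewrite lerD2r -con_theta; last exact: ltnW.
    by apply: con_le; rewrite mulr2n; lra.
  (* Beyond [pi] the other ends [X j - u (theta j)] of the diameters take over. *)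
  have [|j [r [jM /andP[r0 rL] fE]]] := locate (f - pi).
    by move: f2; rewrite mulr2n; lra.
  have [th0 thpi] := theta_bounds j jM; have [_ X2] := Xstep j jM.
  have /andP[H0 _] := Xheight j z (ltnW jM) zs.
  have /andP[H1 _] := Xheight j.+1 z jM zs.
  rewrite -/z' -/(theta j) in H0; rewrite -/z' -/(theta j.+1) thetaS in H1.
  have fE' : f = theta j + pi + r by rewrite addrAC -fE subrK.
  rewrite fE'; apply: (@le_trans _ _ (height (theta j + pi + r) (X j - u (theta j)) + L
    ^+ 2)).
    apply: (@height_interpolation_le _ _ L r _ _ _ (X j.+1 - u (theta j + L))) => //.
    - by rewrite r0.
    - by rewrite !heightDpi heightB height_circle subrr cos0; lra.
    - by rewrite addrAC !heightDpi heightB height_circle subrr cos0; lra.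
    - have := height_le_dist (theta j + L) (X j) (X j.+1 - u (theta j + L)).
      rewrite [theta j + pi + L]addrAC heightDpi !heightB !height_circle subrr cos0
        [theta j + L - _]addrAC subrr add0r.
      by move: X2; rewrite -/(theta j.+1) thetaS => X2; lra.
  rewrite lerD2r -con_theta; last exact: ltnW.
  rewrite -conDpi; last by lra.
  by apply: con_le; rewrite mulr2n; lra.
pose o := body_center (X 0%N) M.*2.+1 tau.
have ocon f : 0 <= f <= pi *+ 2 -> height f o + 4^-1 <= height f (con f).
  exact: (height_body_center _ t0 tlt tpi nodd cpi spi).
have Ko : K' o by move=> f f2; have := ocon f f2; rewrite -/con; lra.
clearbody o.
have K'dist x y : K' x -> K' y -> eucl_dist x y <= 1.
  exact: (swept_body_dist t0 tlt tpi nodd cpi spi).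
(* The body has a margin of 1/4 around [o], so contracting by [(1 + e)^-1] towards [o] gains
   [e / 4], which makes up for the excess [L ^+ 2]. *)
pose e := 4 * L ^+ 2; have e0 : 0 <= e by rewrite mulr_ge0.
move=> x Kx; have [z zs xz] := netK x Kx.
pose z' := (1 - d) *: z + d *: z0; pose y := o + (1 + e)^-1 *: (z' - o).
have e1 : 0 < 1 + e by lra.
have hy f : (1 + e) * (height f y - height f o) = height f z' - height f o.
  have -> : height f y = height f o + (1 + e)^-1 * (height f z' - height f o).
    by rewrite /y heightD heightZ heightB.
  by field; rewrite gt_eqF.
have Ky : K' y.
  move=> f f2; have := near z f zs f2; have := ocon f f2; rewrite -/z' -/con => H1 H2.
  rewrite -(lerD2r (- height f o)) -(ler_pM2l e1) hy.
  have : e * 4^-1 <= e * (height f (con f) - height f o) by rewrite ler_wpM2l//; lra.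
  by rewrite mulrDl mul1r /e; lra.
exists y => //.
have zz' : eucl_dist z z' <= d.
  apply: eucl_dist_leP => f _; rewrite /z' heightD !heightZ.
  have := height_le_dist f z z0; have := dK _ _ (sK _ zs) (sK _ z0s) => H1 H2.
  have : d * (height f z - height f z0) <= d * 1 by rewrite ler_pM2l//; lra.
  lra.
have z'y : eucl_dist z' y <= e.
  apply: eucl_dist_leP => f _.
  have := height_le_dist f y o; have := K'dist _ _ Ky Ko => H1 H2.
  have := hy f; rewrite mulrDl mul1r.
  have : e * (height f y - height f o) <= e * 1 by rewrite ler_wpM2l//; lra.
  lra.
(* As [pi < 4], the total error [2 d + e = 2 d + 4 L^2] is at most [66 d]. *)
have LE : L ^+ 2 <= 16 * d.
  rewrite /L /d expr_div_n ler_pM2r//.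
  have := @ler_pXn2r R 2 isT pi 4; rewrite !nnegrE => /(_ (ltW p0) (ler0n _ _)) E.
  by apply: le_trans (_ : 4 ^+ 2 <= _); [rewrite E ltW|lra].
have := eucl_dist_triangle z x y; have := eucl_dist_triangle z' z y.
by move: LE; rewrite -/d /e in z'y *; lra.
Qed.

End Approximation.

(** * From the approximation rate to the bound on the areas *)

Local Open Scope ereal_scope.

Theorem theoremS6p5 (R : realType) :
  exists C : R, (0 < C)%R /\
    forall M : nat, (1 <= M)%N ->
      0 <= a_Leb R - Lambda R M /\
      a_Leb R - Lambda R M <= (C * M%:R ^- 2)%:E.
Proof.
(* A round value above [4 * (264 + 132^2)], where 4 bounds [Lambda] and [132 = 2 * 66]. *)
exists (300 ^+ 2)%R; split=> [|M M1].
  exact: exprn_gt0 (ltr0Sn R _).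
have aL := Lambda_le_aLeb (R := R) M; have L0 := Lambda_ge0 (R := R) M.
have a4 := aLeb_le4 (R := R).
have [l lE] : exists l, Lambda R M = l%:E.
  by exists (fine (Lambda R M));
    rewrite fineK// ge0_fin_numE// (le_lt_trans (le_trans aL a4))// ltry.
have [r rE] : exists r, a_Leb R = r%:E.
  exists (fine (a_Leb R)); rewrite fineK// ge0_fin_numE; last exact: le_trans L0 aL.
  by rewrite (le_lt_trans a4)// ltry.
move: aL L0 a4; rewrite lE rE -EFinB !lee_fin => aL L0 a4.
split; first by rewrite subr_ge0.
(* The approximation assumes [M > 1]; for [M = 1] the bound [a_Leb <= 4] suffices. *)
have [M_gt1|] := ltnP 1 M; last first.
  by move=> ?; have -> : M = 1%N by [lia]; rewrite expr1n invr1; lra.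
have e0 : (0 < 66 * M%:R ^- 2 :> R)%R by rewrite mulr_gt0// invr_gt0 exprn_gt0// ltr0n.
have := aLeb_le_of_approx e0 (M := M); rewrite lE rE -EFinM lee_fin => H.
have {}H : (r <= (1 + 2 * (66 * M%:R ^- 2)) ^+ 2 * l)%R.
  apply: H => K /(reuleaux_approximation M_gt1)[K' rK' KK'].
  by exists K' => //; right; exists M; rewrite ?M1 ?leqnn.
have M2 : (M%:R ^- 2 <= 1 :> R)%R.
  by rewrite invf_le1 ?exprn_gt0 ?ltr0n// exprn_ege1// ler1n.
have i0 : (0 < M%:R ^- 2 :> R)%R by rewrite invr_gt0 exprn_gt0// ltr0n.
move: (M%:R ^- 2)%R M2 i0 H {e0} => i M2 i0 H.
apply: le_trans (_ : (((1 + 2 * (66 * i)) ^+ 2 - 1) * l <= _)%R); first lra.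
have -> : ((1 + 2 * (66 * i)) ^+ 2 - 1 = i * (264 + 132 ^+ 2 * i))%R by ring.
have bnd : (264 + 132 ^+ 2 * i <= 134 ^+ 2 :> R)%R.
  by apply: le_trans (_ : 264 + 132 ^+ 2 <= _)%R;
    [rewrite lerD2l ler_piMr ?exprn_ge0|lra].
have -> : (300 ^+ 2 * i = i * (75 ^+ 2 * 4) * 4)%R by ring.
have g0 : (0 <= 264 + 132 ^+ 2 * i)%R by exact: addr_ge0 (ler0n R _) (mulr_ge0
  (exprn_ge0 2 (ler0n R _)) (ltW i0)).
apply: (ler_pM (mulr_ge0 (ltW i0) g0) L0 _ (le_trans aL a4)).
by rewrite (ler_pM2l i0); apply: le_trans bnd _; lra.
Qed.
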